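(* Let $(H,\boldsymbol{g})$ be a finite-dimensional pivotal Hopf algebra over a field $\Bbbk$ with modulus $\boldsymbol{\alpha}\in H^*$, and let $\varphi\colon H\to H$, $\varphi=(\boldsymbol{\alpha}\otimes\mathrm{id})\circ\Delta$. The space of right module traces on $(H\text{-pmod},\varphi_* )$ is $1$-dimensional, and the traces are determined uniquely by their values on the regular representation: $$\mathsf{t}_H(f)=\boldsymbol{\mu}\bigl(\boldsymbol{g}\cdot f(1)\bigr),\qquad f\in \mathrm{Hom}_H(H,{}_\varphi H),$$ where $\boldsymbol{\mu}$ is the right integral (unique up to scalar). In particular, $H\text{-pmod}$ has a non-zero right modified trace if and only if $H$ is unimodular.
   Context: $H$-mod is the category of finite-dimensional left $H$-modules, and $H$-pmod is its full subcategory of projective modules. A pivotal Hopf algebra $(H,\boldsymbol g)$ is a Hopf algebra with a group-like element $\boldsymbol g$ (the pivot) such that $S^2(a)=\boldsymbol g a\boldsymbol g^{-1}$ for all $a\in H$. A left cointegral is a nonzero $\boldsymbol c\in H$ with $a\boldsymbol c=\varepsilon(a)\boldsymbol c$ for all $a$ (unique up to scalar). The modulus is the group-like functional (algebra map) $\boldsymbol\alpha\colon H\to\Bbbk$ with $\boldsymbol c a=\boldsymbol\alpha(a)\boldsymbol c$ for all $a$. $H$ is unimodular if $\boldsymbol\alpha=\varepsilon$. A right integral is a nonzero $\boldsymbol\mu\in H^*$ with $(\boldsymbol\mu\otimes\mathrm{id})\Delta(a)=\boldsymbol\mu(a)1$ for all $a$. The map $\varphi=(\boldsymbol\alpha\otimes\mathrm{id})\circ\Delta$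 is an algebra automorphism of $H$. The twist functor $\varphi_*$ sends a module $P$ to ${}_\varphi P$, the same vector space with action $a\cdot_\varphi p=\varphi(a)p$, and is the identity on morphisms; it preserves $H$-pmod. One has $\varphi_*(P\otimes V)=\varphi_*(P)\otimes V$ as $H$-modules. A right module trace on $(H\text{-pmod},\Sigma)$, with $\Sigma=\varphi_*$ (or $\Sigma=\mathrm{Id}$), is a family of $\Bbbk$-linear maps $\{\mathsf t_P\colon \mathrm{Hom}_H(P,\Sigma(P))\to\Bbbk\}_{P\in H\text{-pmod}}$ such that: (1) ($\Sigma$-cyclicity) $\mathsf t_P(f\circ g)=\mathsf t_{P'}(\Sigma(g)\circ f)$ for all $g\colon P\to P'$, $f\colon P'\to\Sigma(P)$ in $H$-pmod; (2) (right partial trace property) for all $P\in H$-pmod, $V\in H$-mod and $f\colon P\otimes V\to\Sigma(P\otimes V)=\Sigma(P)\otimes V$, one has $\mathsf t_{P\otimes V}(f)=\mathsf t_P(\mathrm{tr}_V(f))$, where $\mathrm{tr}_V(f)=(\mathrm{id}\otimes\widetilde{\mathrm{ev}}_V)\circ(f\otimes\mathrm{id}_{V^*})\circ(\mathrm{id}_P\otimes\mathrm{coev}_V)$, with $\mathrm{coev}_V(1)=\sum_i v_i\otimes v_i^*$ for a basis $\{v_i\}$ of $V$ and $\widetilde{\mathrm{ev}}_V(v\otimes\xi)=\xi(\boldsymbol g v)$. A right modified trace on $H$-pmod is a right module trace for $\Sigma=\mathrm{Id}$. *)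

(* Defs.v *)
From HB Require Import structures.
From mathcomp Require Import all_boot all_order all_algebra all_field.

Set Implicit Arguments.
Unset Strict Implicit.
Unset Printing Implicit Defensive.

Import GRing.Theory.
Local Open Scope ring_scope.

(* A concrete model of V (x) W: the matrices of coordinates with respect to
   the products of the elements of the bases [vbasis fullv] of V and W. *)
Section Tensor.
Variable k : fieldType.

Definition tens (V W : vectType k) : vectType k :=
  Vector.clone k 'M[k]_(\dim {:V}, \dim {:W}) _.

Definition ebasis (V : vectType k) (i : 'I_(\dim {:V})) : V := (vbasis {:V})`_i.
Definition ecoord (V : vectType k) (i : 'I_(\dim {:V})) (v : V) : k :=
  coord (vbasis {:V}) i v.

Definition tpure (V W : vectType k) (v : V) (w : W) : tens V W :=
  \matrix_(i, j) (ecoord i v * ecoord j w).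

Section Lift.
Variables (V W U : vectType k) (f : V -> W -> U).

Definition tlift_fun (x : tens V W) : U :=
  \sum_i \sum_j x i j *: f (ebasis i) (ebasis j).

Fact tlift_fun_is_linear : linear tlift_fun.
Proof.
move=> a x y; rewrite /tlift_fun scaler_sumr -big_split; apply: eq_bigr => i _.
rewrite scaler_sumr -big_split; apply: eq_bigr => j _ /=.
by rewrite !mxE scalerDl scalerA.
Qed.
HB.instance Definition _ :=
  GRing.isLinear.Build k (tens V W) U _ tlift_fun tlift_fun_is_linear.

(* For bilinear f, this is the linear map sending v (x) w to f v w,
   see [tliftE]. *)
Definition tlift : 'Hom(tens V W, U) := linfun tlift_fun.
End Lift.

Definition tmap (V V' W W' : vectType k) (f : 'Hom(V, V')) (g : 'Hom(W, W')) :
    'Hom(tens V W, tens V' W') :=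
  tlift (fun v w => tpure (f v) (g w)).

Definition tassoc (U V W : vectType k) :
    'Hom(tens (tens U V) W, tens U (tens V W)) :=
  tlift (fun x w => tlift (fun u v => tpure u (tpure v w)) x).

Definition tassocV (U V W : vectType k) :
    'Hom(tens U (tens V W), tens (tens U V) W) :=
  tlift (fun u y => tlift (fun v w => tpure (tpure u v) w) y).

Definition tlunit (V : vectType k) : 'Hom(tens k^o V, V) :=
  tlift (fun (c : k^o) v => (c : k) *: v).

Definition trunit (V : vectType k) : 'Hom(tens V k^o, V) :=
  tlift (fun v (c : k^o) => (c : k) *: v).

Definition trunitV (V : vectType k) : 'Hom(V, tens V k^o) :=
  linfun (fun v => tpure v (1 : k^o)).

Lemma ebasisE (V : vectType k) (v : V) : v = \sum_i ecoord i v *: ebasis i.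
Proof. exact: coord_vbasis (memvf v). Qed.

Lemma ecoord_ebasis (V : vectType k) (i j : 'I_(\dim {:V})) :
  ecoord j (ebasis i) = (i == j)%:R.
Proof.
by rewrite /ecoord /ebasis coord_free ?(basis_free (vbasisP _)) // eq_sym.
Qed.

Lemma ecoord_is_linear (V : vectType k) (i : 'I_(\dim {:V})) :
  linear (ecoord i : V -> k^o).
Proof. by move=> a u v; rewrite /ecoord linearP. Qed.
HB.instance Definition _ (V : vectType k) i :=
  GRing.isLinear.Build k V k^o _ (@ecoord V i : V -> k^o) (ecoord_is_linear i).

Lemma tpure_linl (V W : vectType k) (w : W) :
  linear (fun v : V => tpure v w).
Proof.
move=> a u v; apply/matrixP => i j; rewrite !mxE.
by rewrite (ecoord_is_linear i a u v) mulrDl mulrA.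
Qed.

Lemma tpure_linr (V W : vectType k) (v : V) : linear (tpure v : W -> _).
Proof.
move=> a u w; apply/matrixP => i j; rewrite !mxE.
by rewrite (ecoord_is_linear j a u w) mulrDr mulrCA.
Qed.

Lemma tens_decomp (V W : vectType k) (x : tens V W) :
  x = \sum_i \sum_j x i j *: tpure (ebasis i) (ebasis j).
Proof.
apply/matrixP => i j; rewrite summxE (bigD1 i) //= [X in _ + X]big1.
  rewrite addr0 summxE (bigD1 j) //= [X in _ + X]big1 => [|l ne_lj].
    by rewrite addr0 !mxE !ecoord_ebasis !eqxx !mulr1.
  by rewrite !mxE !ecoord_ebasis (negbTE ne_lj) !mulr0.
move=> l ne_li; rewrite summxE big1 // => m _.
by rewrite !mxE !ecoord_ebasis (negbTE ne_li) mul0r mulr0.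
Qed.

Lemma tpureZl (V W : vectType k) a (v : V) (w : W) :
  tpure (a *: v) w = a *: tpure v w.
Proof.
apply/matrixP => i j; rewrite !mxE mulrA; congr (_ * _).
by rewrite /ecoord linearZ.
Qed.

Lemma tens_ind (V W : vectType k) (P : tens V W -> Prop) :
  P 0 -> (forall x y, P x -> P y -> P (x + y)) ->
  (forall v w, P (tpure v w)) -> forall x, P x.
Proof.
move=> P0 PD Pp x; rewrite (tens_decomp x).
by do 2!apply: big_ind => // ? _; rewrite -tpureZl.
Qed.

Lemma tliftE (V W U : vectType k) (f : V -> W -> U) :
  (forall w, linear (f^~ w)) -> (forall v, linear (f v)) ->
  forall v w, tlift f (tpure v w) = f v w.
Proof.
move=> fl fr v w; rewrite lfunE /= /tlift_fun.
pose L w := HB.pack (f^~ w) (GRing.isLinear.Build k V U _ (f^~ w) (fl w))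
  : {linear V -> U}.
pose R v := HB.pack (f v) (GRing.isLinear.Build k W U _ (f v) (fr v))
  : {linear W -> U}.
rewrite {2}(ebasisE v) -[RHS]/(L w _) linear_sum; apply: eq_bigr => i _.
rewrite linearZ /= -[f _ w]/(R _ w) {2}(ebasisE w) linear_sum scaler_sumr.
by apply: eq_bigr => j _; rewrite linearZ /= scalerA mxE.
Qed.

Lemma tmapE (V V' W W' : vectType k) (f : 'Hom(V, V')) (g : 'Hom(W, W')) v w :
  tmap f g (tpure v w) = tpure (f v) (g w).
Proof.
rewrite /tmap tliftE // => [{}w|{}v] a x y; rewrite linearP.
  exact: tpure_linl.
exact: tpure_linr.
Qed.

Lemma tlunitE (V : vectType k) (c : k^o) (v : V) :
  tlunit V (tpure c v) = (c : k) *: v.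
Proof.
rewrite /tlunit tliftE // => [{}v|{}c] a x y.
  by rewrite scalerDl scalerA.
by rewrite scalerDr !scalerA mulrC.
Qed.

Lemma tlfunP (V W U : vectType k) (f g : 'Hom(tens V W, U)) :
  (forall v w, f (tpure v w) = g (tpure v w)) -> f = g.
Proof.
move=> fg; apply/lfunP; elim/tens_ind => [|x y fgx fgy|v w]; last exact: fg.
  by rewrite !linear0.
by rewrite !linearD /= fgx fgy.
Qed.

Lemma tmap_id (V W : vectType k) : tmap \1 \1 = \1%VF :> 'End(tens V W).
Proof. by apply: tlfunP => v w; rewrite tmapE !id_lfunE. Qed.

Lemma tmap_comp (V V' V'' W W' W'' : vectType k)
  (f' : 'Hom(V', V'')) (f : 'Hom(V, V')) (g' : 'Hom(W', W''))
  (g : 'Hom(W, W')) :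
  (tmap (f' \o f) (g' \o g) = tmap f' g' \o tmap f g)%VF.
Proof. by apply: tlfunP => v w; rewrite comp_lfunE !tmapE !comp_lfunE. Qed.

(* The action of H (x) H on V (x) W induced by linear maps H -> End V and
   H -> End W. *)
Definition tact (H V W : vectType k)
    (rV : 'Hom(H, 'End(V))) (rW : 'Hom(H, 'End(W))) :
    'Hom(tens H H, 'End(tens V W)) :=
  tlift (fun a b => tmap (rV a) (rW b)).

Lemma tactE (H V W : vectType k) (rV : 'Hom(H, 'End(V)))
    (rW : 'Hom(H, 'End(W))) a b :
  tact rV rW (tpure a b) = tmap (rV a) (rW b).
Proof.
rewrite /tact tliftE // => [{}b|{}a] c x y.
  apply: tlfunP => v w; rewrite add_lfunE scale_lfunE !tmapE linearP.
  by rewrite add_lfunE scale_lfunE tpure_linl.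
apply: tlfunP => v w; rewrite add_lfunE scale_lfunE !tmapE linearP.
by rewrite add_lfunE scale_lfunE tpure_linr.
Qed.
End Tensor.

Section Hopf.
Variables (k : fieldType) (H : falgType k).

Definition lmulr : 'Hom(H, 'End(H)) := linfun (@amull k H).

Definition tmul (x y : tens H H) : tens H H := tact lmulr lmulr x y.

Definition multmap : 'Hom(tens H H, H) := tlift (fun a b : H => a * b).

Record hopfStruct := HopfStruct {
  Delta : 'Hom(H, tens H H);
  eps : {lrmorphism H -> k^o};
  antipode : 'End(H);
  Delta_coassoc :
    (tassoc H H H \o tmap Delta \1 \o Delta = tmap \1 Delta \o Delta)%VF;
  Delta_counitl : (tlunit H \o tmap (linfun eps) \1 \o Delta)%VF = \1%VF;
  Delta_counitr : (trunit H \o tmap \1 (linfun eps) \o Delta)%VF = \1%VF;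
  Delta1 : Delta 1 = tpure 1 1;
  DeltaM : forall a b, Delta (a * b) = tmul (Delta a) (Delta b);
  antipodel : forall a, (multmap \o tmap antipode \1 \o Delta)%VF a = eps a *: 1;
  antipoder : forall a, (multmap \o tmap \1 antipode \o Delta)%VF a = eps a *: 1
}.

Variable X : hopfStruct.

Definition grouplike (g : H) : Prop := Delta X g = tpure g g /\ eps X g = 1.

Definition is_pivot (g : H) : Prop :=
  grouplike g /\ forall a, antipode X (antipode X a) = g * a * g^-1.

Definition left_cointegral (c : H) : Prop :=
  c != 0 /\ forall a, a * c = eps X a *: c.

(* Left cointegrals are unique up to a scalar, so that it does not matter
   which one is used. *)
Definition is_modulus (alpha : {lrmorphism H -> k^o}) : Prop :=
  exists2 c, left_cointegral c & forall a, c * a = alpha a *: c.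

(* (xi (x) id) o Delta *)
Definition slicel (xi : 'Hom(H, k^o)) : 'End(H) :=
  (tlunit H \o tmap xi \1 \o Delta X)%VF.

Definition right_integral (mu : 'Hom(H, k^o)) : Prop :=
  mu != 0 /\ forall a, slicel mu a = mu a *: 1.

Definition modular_aut (alpha : {lrmorphism H -> k^o}) : H -> H :=
  slicel (linfun alpha).

Lemma lmulrE a b : lmulr a b = a * b.
Proof. by rewrite !lfunE. Qed.

Lemma tmulE a b c d : tmul (tpure a b) (tpure c d) = tpure (a * c) (b * d).
Proof. by rewrite /tmul tactE tmapE !lmulrE. Qed.

Section ModularAut.
Variable alpha : {lrmorphism H -> k^o}.

Fact modular_aut_is_linear : linear (modular_aut alpha).
Proof. exact: linearP. Qed.

Fact modular_aut_is_monoid : monoid_morphism (modular_aut alpha).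
Proof.
pose L := (tlunit H \o tmap (linfun alpha) \1)%VF.
have LE a b : L (tpure a b) = (alpha a : k) *: b.
  by rewrite comp_lfunE tmapE tlunitE lfunE id_lfunE.
have mE a : modular_aut alpha a = L (Delta X a).
  by rewrite /modular_aut comp_lfunE.
split=> [|a b]; rewrite !mE; first by rewrite Delta1 LE rmorph1 scale1r.
rewrite DeltaM; elim/tens_ind: (Delta X a) => [|x y IHx IHy|{}a a'].
- by rewrite /tmul linear0 zero_lfunE !linear0 mul0r.
- by rewrite /tmul linearD add_lfunE [LHS]linearD /= IHx IHy linearD mulrDl.
elim/tens_ind: (Delta X b) => [|x y IHx IHy|{}b b'].
- by rewrite /tmul !linear0 mulr0.
- by rewrite /tmul linearD [LHS]linearD /= IHx IHy linearD mulrDr.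
by rewrite tmulE !LE rmorphM -scalerAl -scalerAr scalerA.
Qed.

HB.instance Definition _ :=
  GRing.isLinear.Build k H H _ (modular_aut alpha) modular_aut_is_linear.
HB.instance Definition _ :=
  GRing.isMonoidMorphism.Build H H (modular_aut alpha) modular_aut_is_monoid.
End ModularAut.

Record hmod := HMod {
  hmod_space :> vectType k;
  act : 'Hom(H, 'End(hmod_space));
  act1 : act 1 = \1%VF;
  actM : forall a b, act (a * b) = (act a \o act b)%VF
}.

Definition hlinear (P Q : hmod) (f : 'Hom(P, Q)) : Prop :=
  forall a p, f (act P a p) = act Q a (f p).

(* Projective objects of the category of finite-dimensional modules. *)
Definition projective (P : hmod) : Prop :=
  forall (M N : hmod) (q : 'Hom(M, N)) (f : 'Hom(P, N)),
    hlinear q -> hlinear f -> (forall n, exists m, q m = n) ->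
    exists2 h : 'Hom(P, M), hlinear h & (q \o h)%VF = f.

Fact reg_act1 : lmulr 1 = \1%VF.
Proof. by apply/lfunP => a; rewrite lmulrE mul1r id_lfunE. Qed.

Fact reg_actM a b : lmulr (a * b) = (lmulr a \o lmulr b)%VF.
Proof. by apply/lfunP => c; rewrite comp_lfunE !lmulrE mulrA. Qed.

Definition hreg : hmod := HMod reg_act1 reg_actM.

Section TensorModule.
Variables P V : hmod.

Definition tens_act : 'Hom(H, 'End(tens P V)) :=
  (tact (act P) (act V) \o Delta X)%VF.

Fact tens_act1 : tens_act 1 = \1%VF.
Proof. by rewrite comp_lfunE Delta1 tactE !act1 tmap_id. Qed.

Fact tens_actM a b : tens_act (a * b) = (tens_act a \o tens_act b)%VF.
Proof.
rewrite /tens_act !comp_lfunE DeltaM.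
elim/tens_ind: (Delta X a) => [|x y IHx IHy|{}a a'].
- by rewrite /tmul linear0 zero_lfunE !linear0 comp_lfun0l.
- by rewrite /tmul linearD add_lfunE [LHS]linearD /= IHx IHy linearD comp_lfunDl.
elim/tens_ind: (Delta X b) => [|x y IHx IHy|{}b b'].
- by rewrite /tmul !linear0 comp_lfun0r.
- by rewrite /tmul linearD [LHS]linearD /= IHx IHy linearD comp_lfunDr.
by rewrite tmulE !tactE !actM tmap_comp.
Qed.

Definition htens : hmod := HMod tens_act1 tens_actM.
End TensorModule.

Section Twist.
Variable sigma : {lrmorphism H -> H}.

Section TwistObj.
Variable P : hmod.

Definition twist_act : 'Hom(H, 'End(P)) := (act P \o linfun sigma)%VF.

Fact twist_act1 : twist_act 1 = \1%VF.
Proof. by rewrite comp_lfunE lfunE /= rmorph1 act1. Qed.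

Fact twist_actM a b : twist_act (a * b) = (twist_act a \o twist_act b)%VF.
Proof. by rewrite /twist_act !comp_lfunE !lfunE /= rmorphM actM. Qed.

Definition twist : hmod := HMod twist_act1 twist_actM.
End TwistObj.

Definition twist_map (P Q : hmod) (f : 'Hom(P, Q)) : 'Hom(twist P, twist Q) := f.
End Twist.

Definition coev (V : hmod) : 'Hom(k^o, tens V 'Hom(V, k^o)) :=
  linfun (fun c : k^o =>
    (c : k) *: \sum_i tpure (ebasis i) (linfun (ecoord i : V -> k^o))).

Section Trace.
Variable g : H.

Definition evt (V : hmod) : 'Hom(tens V 'Hom(V, k^o), k^o) :=
  tlift (fun (v : V) (xi : 'Hom(V, k^o)) => xi (act V g v)).

Definition ptrace (U W : vectType k) (V : hmod)
    (f : 'Hom(tens U V, tens W V)) : 'Hom(U, W) :=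
  (trunit W \o tmap \1 (evt V) \o tassoc W V 'Hom(V, k^o)
   \o tmap f \1 \o tassocV U V 'Hom(V, k^o) \o tmap \1 (coev V)
   \o trunitV U)%VF.

Section ModuleTrace.
Variable sigma : {lrmorphism H -> H}.
Notation Sigma := (twist sigma).

(* A family of functionals on the spaces Hom_H(P, Sigma P) for P projective is
   represented by a family defined for all modules P and all linear maps from
   P to Sigma P. Only its values at projective modules and H-linear maps are
   meaningful: [is_module_trace] constrains no other value, and families are
   compared up to [eq_trace]. *)
Definition trace_family := forall P : hmod, 'Hom(P, Sigma P) -> k.

Definition eq_trace (t t' : trace_family) : Prop :=
  forall P, projective P -> forall f : 'Hom(P, Sigma P), hlinear f ->
  t P f = t' P f.

Record is_module_trace (t : trace_family) : Prop := IsModuleTrace {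
  trace_linear : forall P, projective P ->
    forall (c : k) (f f' : 'Hom(P, Sigma P)), hlinear f -> hlinear f' ->
    t P (c *: f + f') = c * t P f + t P f';
  trace_cyclic : forall P P', projective P -> projective P' ->
    forall (h : 'Hom(P, P')) (f : 'Hom(P', Sigma P)), hlinear h -> hlinear f ->
    t P (f \o h)%VF = t P' (twist_map sigma h \o f)%VF;
  (* Sigma (P (x) V) and Sigma P (x) V have the same underlying space, so that
     [ptrace] applies to f. *)
  trace_partial : forall P V, projective P ->
    forall f : 'Hom(htens P V, Sigma (htens P V)), hlinear f ->
    t (htens P V) f = t P (@ptrace P (Sigma P) V f)
}.

Definition trace0 : trace_family := fun _ _ => 0.
Definition trace_scale (c : k) (t : trace_family) : trace_family :=
  fun P f => c * t P f.

Definition nonzero_trace (t : trace_family) : Prop := ~ eq_trace t trace0.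

Definition traces_dim1 : Prop :=
  exists t0, [/\ is_module_trace t0, nonzero_trace t0 &
    forall t, is_module_trace t -> exists c, eq_trace t (trace_scale c t0)].
End ModuleTrace.

Definition is_modified_trace : trace_family idfun -> Prop :=
  @is_module_trace idfun.
End Trace.
End Hopf.

(* Submission.v *)
From HB Require Import structures.
From Stdlib Require Import ClassicalEpsilon.
Require Import Defs.
From mathcomp Require Import all_boot all_order all_algebra all_field.

Set Implicit Arguments.
Unset Strict Implicit.
Unset Printing Implicit Defensive.

Import GRing.Theory.
Local Open Scope ring_scope.

(** Every trace reduces to a linear form. A projective module P has a dual
    basis: vectors p_i and H-linear q_i : P -> H with x = sum_i q_i(x) p_i.
    Cyclicity along the maps H -> P, 1 |-> p_i, and q_i forces
    t_P(f) = sum_i lam(q_i(f(p_i))), where lam(a) is the value of t_H at the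
    H-linear map sending 1 to a (module_traceE). In the other direction, this
    formula defines a family that satisfies cyclicity, and does not depend on
    the dual basis, as soon as lam(ab) = lam(sigma(b)a) (twisted_cyclicity).

    The partial trace property is a condition on lam alone. If (p_i, q_i) is a
    dual basis of P, then the vectors p_i (x) v_j and the coordinates
    x (x) v |-> q_i(x)_1 v_j^*(S(q_i(x)_2) v) form one of P (x) V. Comparing
    both sides of the property in these coordinates gives
    lam(a_1) S(a_2) = lam(a) g: sufficiency is trace_of_module_trace, and
    necessity, tested on V = H, is trace_form_integral. With lam(a) = mu(g a)
    this equation says that mu is a right integral
    (integral_form_right_integral).

    It remains to know the right integrals. Let c be a left cointegral and let
    Phi(xi) = xi(c_1) c_2. The image of Phi is a left ideal and a left coideal
    on which the counit does not vanish, so it contains S(y_1) y_2 = 1 for some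
    y; hence Phi is bijective (cointegral_map_surj, cointegral_map_inj). The
    right integrals are exactly the nonzero multiples of the preimage of 1, which
    gives existence and uniqueness. Applying Phi to the forms mu(S(a) -) and mu(- b)
    yields mu(c) a and mu(c) S(phi(b)); therefore mu is nondegenerate and
    mu(ab) = mu(S^2(phi(b)) a) (right_integral_nakayama). As S^2 is conjugation
    by g, the form mu(g -) satisfies the cyclicity condition for sigma = phi.
    It satisfies the one for sigma = id iff phi = id, by nondegeneracy, and
    phi = id iff alpha is the counit. *)

(** * Linearity of functions built from linear ones *)
Section LinearFunctions.
Variable k : fieldType.
Implicit Types U V W : lmodType k.

Lemma lin_id V : linear (fun v : V => v).
Proof. by []. Qed.

Lemma lin_comp U V W (L : {linear V -> W}) (A : U -> V) :
  linear A -> linear (fun z => L (A z)).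
Proof. by move=> lA c x y; rewrite lA linearP. Qed.

Lemma lin_Z U V (L : U -> V) c v : linear L -> L (c *: v) = c *: L v.
Proof.
move=> lL; pose L' := HB.pack L (GRing.isLinear.Build k U V _ L lL)
  : {linear U -> V}.
exact: (linearZ_LR L').
Qed.

Lemma lin_bigsum U V (L : U -> V) (I : finType) (f : I -> U) :
  linear L -> L (\sum_i f i) = \sum_i L (f i).
Proof.
move=> lL; pose L' := HB.pack L (GRing.isLinear.Build k U V _ L lL)
  : {linear U -> V}.
exact: (linear_sum L').
Qed.

Lemma lin_scalel U V (A : U -> k^o) (v : V) :
  linear A -> linear (fun z => (A z : k) *: v).
Proof. by move=> lA c x y; rewrite lA scalerDl scalerA. Qed.

Lemma lin_scaler U V (a : k) (A : U -> V) :
  linear A -> linear (fun z => a *: A z).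
Proof. by move=> lA c x y; rewrite lA scalerDr !scalerA mulrC. Qed.

Lemma lin_mull U (B : algType k) (A : U -> B) b :
  linear A -> linear (fun z => A z * b).
Proof. by move=> lA c x y; rewrite lA mulrDl scalerAl. Qed.

Lemma lin_mulr U (B : algType k) (A : U -> B) b :
  linear A -> linear (fun z => b * A z).
Proof. by move=> lA c x y; rewrite lA mulrDr scalerAr. Qed.

Lemma lin_sum U V (I : finType) (A : I -> U -> V) :
  (forall i, linear (A i)) -> linear (fun z => \sum_i A i z).
Proof.
move=> lA c x y; rewrite scaler_sumr -big_split; apply: eq_bigr => i _.
exact: lA.
Qed.
End LinearFunctions.

Section LinearVect.
Variable k : fieldType.
Implicit Types U V W : vectType k.

Lemma lin_lfun U (V W : vectType k) (A : U -> 'Hom(V, W)) v :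
  linear A -> linear (fun z => A z v).
Proof. by move=> lA c x y; rewrite lA add_lfunE scale_lfunE. Qed.

Lemma lin_tpurel U V W (A : U -> V) (w : W) :
  linear A -> linear (fun z => tpure (A z) w).
Proof. by move=> lA c x y; rewrite lA tpure_linl. Qed.

Lemma lin_tpurer U V W (v : V) (A : U -> W) :
  linear A -> linear (fun z => tpure v (A z)).
Proof. by move=> lA c x y; rewrite lA tpure_linr. Qed.

Lemma linear_linfun (V W : vectType k) (f : V -> W) v :
  linear f -> linfun f v = f v.
Proof.
move=> lf; pose L := HB.pack f (GRing.isLinear.Build k V W _ f lf)
  : {linear V -> W}.
exact: (lfunE L).
Qed.

Lemma ecoord_inj V (u v : V) : (forall i, ecoord i u = ecoord i v) -> u = v.
Proof.
by move=> uv; rewrite (ebasisE u) (ebasisE v); apply: eq_bigr => i _; rewrite uv.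
Qed.

Lemma lin_ebasis U V (L : U -> V) v :
  linear L -> L v = \sum_i ecoord i v *: L (ebasis i).
Proof.
move=> lL; rewrite {1}(ebasisE v) lin_bigsum //.
by apply: eq_bigr => i _; rewrite lin_Z.
Qed.

Lemma tlift_ebasisl (V W U : vectType k) (f : V -> W -> U) i w :
  linear (f (ebasis i)) -> tlift f (tpure (ebasis i) w) = f (ebasis i) w.
Proof.
move=> lf; rewrite lfunE /= /tlift_fun (bigD1 i) //= [X in _ + X]big1.
  rewrite addr0 {2}(ebasisE w).
  pose L := HB.pack (f (ebasis i)) (GRing.isLinear.Build k W U _ _ lf)
    : {linear W -> U}.
  rewrite -[RHS]/(L _) linear_sum; apply: eq_bigr => j _.
  by rewrite linearZ !mxE ecoord_ebasis eqxx mul1r.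
move=> l nl; rewrite big1 // => j _.
by rewrite !mxE !ecoord_ebasis eq_sym (negPf nl) mul0r scale0r.
Qed.

Lemma tlift_ebasis (V W U : vectType k) (f : V -> W -> U) i j :
  tlift f (tpure (ebasis i) (ebasis j)) = f (ebasis i) (ebasis j).
Proof.
rewrite lfunE /= /tlift_fun (bigD1 i) //= [X in _ + X]big1 => [|l nl].
  rewrite addr0 (bigD1 j) //= [X in _ + X]big1 => [|l nl].
    by rewrite !mxE !ecoord_ebasis !eqxx mulr1 scale1r addr0.
  by rewrite !mxE !ecoord_ebasis (eq_sym j) (negPf nl) mulr0 scale0r.
rewrite big1 // => m _.
by rewrite !mxE !ecoord_ebasis (eq_sym i) (negPf nl) mul0r scale0r.
Qed.

Lemma tens_eq (U V W : vectType k) (f f' : tens U V -> W) :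
  linear f -> linear f' -> (forall u v, f (tpure u v) = f' (tpure u v)) ->
  forall t, f t = f' t.
Proof.
move=> lf lf' ff' t; elim/tens_ind: t => [|x y IHx IHy|u v]; last exact: ff'.
  by rewrite -(scale0r 0) !lin_Z // !scale0r.
by rewrite -[x]scale1r lf lf' !scale1r IHx IHy.
Qed.

Lemma lin_tlift (U V W T : vectType k) (f : U -> V -> W -> T) x :
  (forall v w, linear (fun z => f z v w)) -> linear (fun z => tlift (f z) x).
Proof.
move=> lf c y z; rewrite !lfunE /= /tlift_fun scaler_sumr -big_split.
apply: eq_bigr => i _; rewrite scaler_sumr -big_split; apply: eq_bigr => j _ /=.
by rewrite lf scalerDr !scalerA mulrC.
Qed.

End LinearVect.

(** * Sweedler sums *)
Reserved Notation "\sw_ ( x , y <- a ) F"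
  (at level 41, x name, y name, F at level 41).

Section SweedlerSums.
Variables (k : fieldType) (H : falgType k) (X : hopfStruct H).

(** The sum of f a_(1) a_(2) in Sweedler notation. Expanding the coproduct in
    the fixed basis makes sense for every f, so that sums can be reordered and
    reassociated without proving f multilinear. *)
Definition sw (U : vectType k) (f : H -> H -> U) (a : H) : U :=
  tlift_fun f (Delta X a).

Local Notation "\sw_ ( x , y <- a ) F" := (sw (fun x y => F) a).

Implicit Types U V : vectType k.

Lemma swE U (f : H -> H -> U) a : sw f a = tlift f (Delta X a).
Proof. by rewrite lfunE. Qed.

Fact sw_is_linear U (f : H -> H -> U) : linear (sw f).
Proof. by move=> c x y; rewrite !swE !linearP. Qed.
HB.instance Definition _ U f :=
  GRing.isLinear.Build k H U _ (sw f) (@sw_is_linear U f).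

Lemma eq_sw_ebasis U (f f' : H -> H -> U) a :
  (forall i j, f (ebasis i) (ebasis j) = f' (ebasis i) (ebasis j)) ->
  sw f a = sw f' a.
Proof.
by move=> ff'; apply: eq_bigr => i _; apply: eq_bigr => j _; rewrite ff'.
Qed.

Lemma eq_sw U (f f' : H -> H -> U) a :
  (forall x y, f x y = f' x y) -> sw f a = sw f' a.
Proof. by move=> ff'; apply: eq_sw_ebasis => i j; apply: ff'. Qed.

Lemma sw_add U (f f' : H -> H -> U) a :
  sw (fun x y => f x y + f' x y) a = sw f a + sw f' a.
Proof.
rewrite -big_split; apply: eq_bigr => i _; rewrite -big_split.
by apply: eq_bigr => j _; rewrite scalerDr.
Qed.

Lemma sw_sum U (I : finType) (f : I -> H -> H -> U) a :
  sw (fun x y => \sum_i f i x y) a = \sum_i sw (f i) a.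
Proof.
rewrite exchange_big; apply: eq_bigr => i _; rewrite exchange_big.
by apply: eq_bigr => j _; rewrite scaler_sumr.
Qed.

Lemma sw_linear (U V : vectType k) (L : V -> U) (f : H -> H -> V) a :
  linear L -> L (sw f a) = sw (fun x y => L (f x y)) a.
Proof.
move=> lL; pose L' := HB.pack L (GRing.isLinear.Build k V U _ L lL)
  : {linear V -> U}.
rewrite -[LHS]/(L' _) linear_sum; apply: eq_bigr => i _.
by rewrite linear_sum; apply: eq_bigr => j _; rewrite linearZ.
Qed.

Lemma lin_sw (U V : vectType k) (f : U -> H -> H -> V) a :
  (forall x y, linear (fun z => f z x y)) -> linear (fun z => sw (f z) a).
Proof.
move=> lf c x y; rewrite -[LHS]/(sw _ a).
have -> : c *: sw (f x) a = \sw_(u, v <- a) (c *: f x u v).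
  exact: (sw_linear _ _ (lin_scaler c (@lin_id _ _))).
by rewrite -sw_add; apply: eq_sw => u v; apply: lf.
Qed.

End SweedlerSums.
Arguments sw_linear {k H X U V L} f a _.
Arguments eq_sw {k H X U f f'} a _.

(** Discharges the linearity side conditions of Sweedler computations by
    following the syntax of the function. *)
Ltac lin := intros; cbv beta;
  first
  [ exact: lin_id
  | exact: linearP
  | apply: lin_tpurel; lin
  | apply: lin_tpurer; lin
  | apply: lin_mull; lin
  | apply: lin_mulr; lin
  | apply: lin_scalel; lin
  | apply: lin_scaler; lin
  | apply: lin_sum; lin
  | apply: lin_sw; lin
  | apply: lin_tlift; lin
  | apply: lin_comp; lin
  | apply: lin_lfun; lin ].

(** * The Hopf algebra axioms for Sweedler sums *)
Section Sweedler.
Variables (k : fieldType) (H : falgType k) (X : hopfStruct H).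
Local Notation S := (antipode X).
Implicit Types U V : vectType k.
Local Notation "\sw_ ( x , y <- a ) F" := (sw X (fun x y => F) a).

Lemma sw_exchange (U : vectType k) (f : H -> H -> H -> H -> U) a b :
  \sw_(x, y <- a) \sw_(u, v <- b) f x y u v =
  \sw_(u, v <- b) \sw_(x, y <- a) f x y u v.
Proof.
have E : linear (fun z : U => z) by [].
transitivity (\sum_i \sum_j
    \sw_(u, v <- b) (Delta X a i j *: f (ebasis i) (ebasis j) u v)).
  apply: eq_bigr => i _; apply: eq_bigr => j _.
  exact: (sw_linear _ _ (lin_scaler _ E)).
rewrite /sw /tlift_fun.
under eq_bigr do rewrite exchange_big.
rewrite exchange_big; apply: eq_bigr => u _ /=.
under eq_bigr do rewrite exchange_big.
rewrite exchange_big; apply: eq_bigr => v _ /=.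
rewrite scaler_sumr; apply: eq_bigr => i _; rewrite scaler_sumr.
by apply: eq_bigr.
Qed.

Lemma sw_tpure a : \sw_(x, y <- a) tpure x y = Delta X a.
Proof. by rewrite [RHS]tens_decomp. Qed.

Lemma sw_lfunE (V : vectType k) (L : 'Hom(tens H H, V)) a :
  L (Delta X a) = \sw_(x, y <- a) L (tpure x y).
Proof.
rewrite {1}(tens_decomp (Delta X a)) linear_sum; apply: eq_bigr => i _.
by rewrite linear_sum; apply: eq_bigr => j _; rewrite linearZ.
Qed.

Lemma tassocE (U V W : vectType k) (u : U) (v : V) (w : W) :
  tassoc U V W (tpure (tpure u v) w) = tpure u (tpure v w).
Proof. by rewrite tliftE ?tliftE //; lin. Qed.

Lemma tassocVE (U V W : vectType k) (u : U) (v : V) (w : W) :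
  tassocV U V W (tpure u (tpure v w)) = tpure (tpure u v) w.
Proof. by rewrite tliftE ?tliftE //; lin. Qed.

Lemma sw_tens_coassoc a :
  \sw_(x, z <- a) \sw_(u, v <- x) tpure u (tpure v z) =
  \sw_(u, z <- a) \sw_(v, w <- z) tpure u (tpure v w).
Proof.
have := congr1 (fun h : 'Hom(H, _) => h a) (Delta_coassoc X).
rewrite [LHS]comp_lfunE [RHS]comp_lfunE !sw_lfunE => E.
transitivity (\sw_(x, z <- a) (tassoc H H H \o tmap (Delta X) \1)%VF (tpure x z)).
  apply: eq_sw => x z; rewrite comp_lfunE tmapE id_lfunE -(sw_tpure x).
  rewrite (sw_linear (L := fun y => tassoc H H H (tpure y z))); last by lin.
  by apply: eq_sw => u v; rewrite tassocE.
rewrite E; apply: eq_sw => x z; rewrite tmapE id_lfunE -{1}(sw_tpure z).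
by rewrite (sw_linear (L := tpure x)) //; lin.
Qed.

(** Both sides only evaluate f at basis vectors, where f agrees with its
    trilinear extension L. *)
Lemma sw_coassoc U (f : H -> H -> H -> U) a :
  \sw_(x, z <- a) \sw_(u, v <- x) f u v z =
  \sw_(u, z <- a) \sw_(v, w <- z) f u v w.
Proof.
pose L : 'Hom(tens H (tens H H), U) := tlift (fun u => tlift (f u)).
have LE i j l :
    L (tpure (ebasis i) (tpure (ebasis j) (ebasis l))) =
    f (ebasis i) (ebasis j) (ebasis l).
  by rewrite tlift_ebasisl ?tlift_ebasis //; apply: linearP.
have lL : linear L by exact: linearP.
have := congr1 L (sw_tens_coassoc a).
rewrite !(sw_linear _ _ lL) => E.
transitivity (\sw_(x, z <- a) L (\sw_(u, v <- x) tpure u (tpure v z))).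
  apply: eq_sw_ebasis => i j; rewrite (sw_linear _ _ lL).
  by apply: eq_sw_ebasis => l m; rewrite LE.
rewrite E; apply: eq_sw_ebasis => i j; rewrite (sw_linear _ _ lL).
by apply: eq_sw_ebasis => l m; rewrite LE.
Qed.

Lemma sw_counitl U (L : H -> U) a :
  linear L -> \sw_(x, y <- a) (eps X x : k) *: L y = L a.
Proof.
move=> lL; have := congr1 (fun h : 'End(H) => L (h a)) (Delta_counitl X).
rewrite comp_lfunE sw_lfunE (sw_linear _ _ lL) id_lfunE => <-; apply: eq_sw => x y.
rewrite comp_lfunE tmapE tlunitE lfunE id_lfunE.
by rewrite lin_Z.
Qed.

Lemma sw_counitr U (L : H -> U) a :
  linear L -> \sw_(x, y <- a) (eps X y : k) *: L x = L a.
Proof.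
move=> lL; have := congr1 (fun h : 'End(H) => L (h a)) (Delta_counitr X).
rewrite comp_lfunE sw_lfunE (sw_linear _ _ lL) id_lfunE => <-; apply: eq_sw => x y.
by rewrite comp_lfunE tmapE tliftE ?lfunE ?id_lfunE ?lin_Z //; lin.
Qed.

Lemma multmapE (a b : H) : multmap H (tpure a b) = a * b.
Proof. by rewrite tliftE //; lin. Qed.

Lemma sw_antipodel U (L : H -> U) a :
  linear L -> \sw_(x, y <- a) L (S x * y) = (eps X a : k) *: L 1.
Proof.
move=> lL; rewrite -lin_Z // -antipodel comp_lfunE sw_lfunE (sw_linear _ _ lL).
by apply: eq_sw => x y; rewrite comp_lfunE tmapE id_lfunE multmapE.
Qed.

Lemma sw_antipoder U (L : H -> U) a :
  linear L -> \sw_(x, y <- a) L (x * S y) = (eps X a : k) *: L 1.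
Proof.
move=> lL; rewrite -lin_Z // -antipoder comp_lfunE sw_lfunE (sw_linear _ _ lL).
by apply: eq_sw => x y; rewrite comp_lfunE tmapE id_lfunE multmapE.
Qed.

Lemma swM U (f : H -> H -> U) a b :
  (forall y, linear (f^~ y)) -> (forall x, linear (f x)) ->
  sw X f (a * b) = \sw_(x, y <- a) \sw_(u, v <- b) f (x * u) (y * v).
Proof.
move=> fl fr; rewrite swE DeltaM -[in LHS](sw_tpure a).
have l1 c : linear (fun x => tlift f (tmul x c)).
  by rewrite /tmul; lin.
rewrite (sw_linear _ _ (l1 _)); apply: eq_sw => x y.
have l2 : linear (fun c => tlift f (tmul (tpure x y) c)).
  by rewrite /tmul; lin.
rewrite -[in LHS](sw_tpure b) (sw_linear _ _ l2); apply: eq_sw => u v.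
by rewrite tmulE tliftE.
Qed.

Lemma sw_grouplike U (f : H -> H -> U) g :
  grouplike X g -> (forall y, linear (f^~ y)) -> (forall x, linear (f x)) ->
  sw X f g = f g g.
Proof. by move=> [Dg _] fl fr; rewrite swE Dg tliftE. Qed.

Lemma sw1 U (f : H -> H -> U) :
  (forall y, linear (f^~ y)) -> (forall x, linear (f x)) ->
  sw X f 1 = f 1 1.
Proof. by move=> fl fr; rewrite swE Delta1 tliftE. Qed.

Lemma antipode1 : S 1 = 1.
Proof.
have := sw_antipodel 1 (@lin_id _ _).
by rewrite sw1 ?mulr1 ?rmorph1 ?scale1r //; lin.
Qed.

(** Evaluate S(b_1) S(a_1) a_2 b_2 S(a_3 b_3) in two ways: the product of the
    first four factors collapses and leaves S(ab), and the product of the last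
    three collapses and leaves S(b) S(a). *)
Lemma antipodeM a b : S (a * b) = S b * S a.
Proof.
pose G a1 p q b1 r s := S b1 * (S a1 * p) * r * S (q * s).
transitivity (\sw_(x, q <- a) \sw_(a1, p <- x) \sw_(y, s <- b)
  \sw_(b1, r <- y) G a1 p q b1 r s).
  rewrite /G; under eq_sw => x q.
    rewrite (sw_antipodel (L := fun z => \sw_(y, s <- b) \sw_(b1, r <- y)
      (S b1 * z * r * S (q * s)))); last by lin.
  over.
  rewrite sw_counitl; last by lin.
  under eq_sw => y s.
    under eq_sw => b1 r do rewrite mulr1.
    rewrite (sw_antipodel (L := fun z => z * S (a * s))); last by lin.
  over.
  by rewrite sw_counitl ?mul1r //; lin.
rewrite sw_coassoc.
transitivity (\sw_(a1, z <- a) \sw_(b1, y <- b) \sw_(p, q <- z) \sw_(r, s <- y)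
  G a1 p q b1 r s).
  apply: eq_sw => a1 z; rewrite [RHS]sw_exchange; apply: eq_sw => p q.
  by rewrite sw_coassoc.
transitivity (\sw_(a1, z <- a) \sw_(b1, y <- b) 
   (eps X z : k) *: ((eps X y : k) *: (S b1 * S a1))).
  apply: eq_sw => a1 z; apply: eq_sw => b1 y.
  rewrite scalerA -[_ * _]/(eps X z * eps X y) -rmorphM -[S b1 * S a1]mulr1.
  rewrite -(sw_antipoder (L := fun z => S b1 * S a1 * z)); last by lin.
  rewrite swM; [|lin..].
  by apply: eq_sw => p q; apply: eq_sw => r s; rewrite /G !mulrA.
under eq_sw => a1 z.
  under eq_sw => b1 y do rewrite scalerA mulrC -scalerA.
  rewrite sw_counitr; last by lin.
over.
by rewrite sw_counitr //; lin.
Qed.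
End Sweedler.

(** * Cointegrals and right integrals *)
Section Integrals.
Variables (k : fieldType) (H : falgType k) (X : hopfStruct H).
Local Notation S := (antipode X).
Local Notation "\sw_ ( x , y <- a ) F" := (sw X (fun x y => F) a).
Implicit Types U V : vectType k.

Lemma slicelE (xi : 'Hom(H, k^o)) a :
  slicel X xi a = \sw_(x, y <- a) (xi x : k) *: y.
Proof.
rewrite /slicel comp_lfunE sw_lfunE; apply: eq_sw => x y.
by rewrite comp_lfunE tmapE tlunitE id_lfunE.
Qed.

Variables (c : H) (hc : left_cointegral X c).

(** S(a) c_1 (x) c_2 = S(a_1) (a_2 c)_1 (x) (a_2 c)_2
    = S(a_1) a_2 c_1 (x) a_3 c_2 = c_1 (x) a c_2. *)
Lemma sw_cointegrall U (f : H -> H -> U) a :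
  (forall y, linear (f^~ y)) -> (forall x, linear (f x)) ->
  \sw_(x, y <- c) f x (a * y) = \sw_(x, y <- c) f (S a * x) y.
Proof.
move=> fl fr.
(* The universal bilinear map, for which linearity conditions are syntactic. *)
have E : \sw_(x, y <- c) tpure x (a * y) = \sw_(x, y <- c) tpure (S a * x) y.
  rewrite -(sw_counitr X (L := fun z => \sw_(x, y <- c) tpure (S z * x) y) a);
    last by lin.
  under [RHS]eq_sw => p q.
    rewrite -linearZ /= -(proj2 hc) swM; [|lin..].
    under eq_sw => u v do under eq_sw => x y do rewrite mulrA.
  over.
  rewrite -sw_coassoc.
  under [RHS]eq_sw => r v.
    rewrite (sw_antipodel X (L := fun z => \sw_(x, y <- c) tpure (z * x) (v * y)));
      last by lin.
    under eq_sw => x y do rewrite mul1r.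
  over.
  by rewrite sw_counitl //; lin.
have := congr1 (tlift f) E; rewrite !(sw_linear (L := tlift f)); [|lin..].
under eq_sw => x y do rewrite tliftE //.
by move=> ->; apply: eq_sw => x y; rewrite tliftE.
Qed.

(** c_1 a (x) c_2 = c_1 a_1 (x) c_2 a_2 S(a_3) = (c a_1)_1 (x) (c a_1)_2 S(a_2),
    and c a_1 is a multiple of c. *)
Lemma sw_cointegralr U (f : H -> H -> U) (alpha : H -> k^o) a :
  linear alpha -> (forall b, c * b = (alpha b : k) *: c) ->
  (forall y, linear (f^~ y)) -> (forall x, linear (f x)) ->
  \sw_(x, y <- c) f (x * a) y =
  \sw_(p, q <- a) (alpha p : k) *: \sw_(x, y <- c) f x (y * S q).
Proof.
move=> la ca fl fr.
have E : \sw_(x, y <- c) tpure (x * a) y =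
    \sw_(p, q <- a) (alpha p : k) *: \sw_(x, y <- c) tpure x (y * S q).
  under [RHS]eq_sw => p q.
    rewrite -(lin_Z (L := fun z => \sw_(x, y <- z) tpure x (y * S q))); last first.
      exact: linearP.
    rewrite -ca swM; [|lin..].
    rewrite sw_exchange.
    under eq_sw => u v do under eq_sw => x y do rewrite -mulrA.
  over.
  rewrite sw_coassoc.
  under [RHS]eq_sw => u z.
    rewrite (sw_antipoder X (L := fun w => \sw_(x, y <- c) tpure (x * u) (y * w)));
      last by lin.
    under eq_sw => x y do rewrite mulr1.
  over.
  by rewrite (sw_counitr X (L := fun u => \sw_(x, y <- c) tpure (x * u) y)) //; lin.
have := congr1 (tlift f) E; rewrite !(sw_linear (L := tlift f)); [|lin..].
under eq_sw => x y do rewrite tliftE //.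
move=> ->; apply: eq_sw => p q; rewrite linearZ /=; congr (_ *: _).
rewrite (sw_linear (L := tlift f)); last by lin.
by apply: eq_sw => x y; rewrite tliftE.
Qed.

(** The map written Phi in the comments. *)
Definition cointegral_map : 'Hom('Hom(H, k^o), H) :=
  linfun (fun xi : 'Hom(H, k^o) => slicel X xi c).

Lemma cointegral_mapE xi : cointegral_map xi = \sw_(x, y <- c) (xi x : k) *: y.
Proof.
rewrite linear_linfun ?slicelE // => b u v; rewrite !slicelE.
by rewrite (lin_sw X (f := fun (z : 'Hom(H, k^o)) x y => (z x : k) *: y)) //; lin.
Qed.

Lemma cointegral_map_mull xi a :
  a * cointegral_map xi = cointegral_map (xi \o lmulr H (S a))%VF.
Proof.
rewrite !cointegral_mapE (sw_linear (L := fun z => a * z)); last by lin.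
under eq_sw => x y do rewrite -scalerAr.
rewrite (sw_cointegrall (f := fun x y => (xi x : k) *: y)); [|lin..].
by apply: eq_sw => x y; rewrite comp_lfunE lmulrE.
Qed.

(** The image is a left ideal by cointegral_map_mull. If xi(c) = 1, then
    a = xi(c_1) a S(c_2) c_3; expanding c_2 in a basis writes this as a sum of
    multiples of elements of the image. *)
Lemma cointegral_map_surj a : exists xi, cointegral_map xi = a.
Proof.
suff: a \in limg cointegral_map by case/memv_imgP => xi _ ->; exists xi.
have [xi xi1] : exists xi : 'Hom(H, k^o), xi c = 1.
  have [i ci] : exists i, ecoord i c != 0.
    apply/existsP; apply: contraR (proj1 hc); rewrite negb_exists => /forallP c0.
    apply/eqP; rewrite (ebasisE c) big1 // => i _; move: (c0 i).
    by rewrite negbK => /eqP ->; rewrite scale0r.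
  exists ((ecoord i c)^-1 *: linfun (ecoord i : H -> k^o)).
  by rewrite scale_lfunE lfunE /= [LHS]mulVf.
have <- : \sw_(x, z <- c) \sw_(u, v <- x) (xi u : k) *: (a * S v * z) = a.
  transitivity ((xi c : k) *: a); last by rewrite xi1 [LHS]scale1r.
  rewrite sw_coassoc.
  rewrite -(sw_counitr X (L := fun z => (xi z : k) *: a)); last by lin.
  apply: eq_sw => u z.
  rewrite -(sw_linear (L := fun w => (xi u : k) *: w)); last by lin.
  under eq_sw => v w do rewrite -mulrA.
  rewrite (sw_antipodel X (L := fun w => a * w)) ?mulr1; last by lin.
  by rewrite !scalerA mulrC.
pose zeta i : 'Hom(H, k^o) :=
  linfun (fun x => \sw_(u, v <- x) (xi u : k) *: (ecoord i v : k^o)).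
have -> : \sw_(x, z <- c) \sw_(u, v <- x) (xi u : k) *: (a * S v * z) =
    \sum_i a * S (ebasis i) * cointegral_map (zeta i).
  transitivity (\sum_i \sw_(x, z <- c)
      \sw_(u, v <- x) ((xi u : k) * (ecoord i v : k)) *: (a * S (ebasis i) * z)).
    rewrite -sw_sum; apply: eq_sw => x z; rewrite -sw_sum; apply: eq_sw => u v.
    rewrite (lin_ebasis v (L := fun v => a * S v * z)) ?scaler_sumr; last by lin.
    by apply: eq_bigr => i _; rewrite scalerA.
  apply: eq_bigr => i _; rewrite cointegral_mapE.
  rewrite (sw_linear (L := fun w => _ * w)); last by lin.
  apply: eq_sw => x z; rewrite -scalerAr linear_linfun; last by lin.
  by rewrite (sw_linear (L := fun w : k^o => (w : k) *: _)) //; lin.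
apply: memv_suml => i _; rewrite cointegral_map_mull; exact: memv_img (memvf _).
Qed.

Lemma cointegral_map_inj : injective cointegral_map.
Proof.
have img : limg cointegral_map = fullv.
  apply/vspaceP => a; rewrite memvf.
  by have [xi <-] := cointegral_map_surj a; rewrite memv_img ?memvf.
apply/lker0P; rewrite -dimv_eq0.
have := limg_ker_dim cointegral_map fullv; rewrite img capfv => /eqP.
rewrite !dimvf [dim 'Hom(_, _)]muln1 -{2}[dim H]add0n.
by rewrite eqn_add2r.
Qed.

(** Phi turns the convolution mu * xi into (xi (x) id) Delta(Phi(mu)), which is
    xi(1) Phi(mu) when Phi(mu) is a scalar; injectivity then gives
    mu * xi = xi(1) mu for every xi. *)
Lemma right_integralP (mu : 'Hom(H, k^o)) :
  (forall a, slicel X mu a = mu a *: 1) <->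
  cointegral_map mu = (mu c : k) *: 1.
Proof.
split=> [mui|E a]; first by rewrite cointegral_mapE -slicelE.
suff conv (xi : 'Hom(H, k^o)) : (xi \o slicel X mu = (xi 1 : k) *: mu)%VF.
  apply: ecoord_inj => i.
  have := congr1 (fun h : 'Hom(H, k^o) => h a) (conv (linfun (ecoord i : H -> k^o))).
  rewrite comp_lfunE scale_lfunE !lfunE /= => ->.
  by rewrite (lin_Z (L := ecoord i : H -> k^o)) 1?[RHS]mulrC //; apply: linearP.
apply: cointegral_map_inj; rewrite linearZ /= E cointegral_mapE.
under eq_sw => x z.
  rewrite comp_lfunE slicelE (sw_linear (L := fun w => (xi w : k) *: z));
    last by lin.
over.
rewrite sw_coassoc.
transitivity (\sw_(u, z <- c) \sw_(v, w <- z) ((mu u : k) *: ((xi v : k) *: w))).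
  by apply: eq_sw => u z; apply: eq_sw => v w; rewrite linearZ scalerA.
under eq_sw => u z.
  rewrite -(sw_linear (L := fun w => (mu u : k) *: w)); last by lin.
  rewrite -(lin_Z (L := fun z => \sw_(v, w <- z) (xi v : k) *: w));
    last by exact: linearP.
over.
rewrite -(sw_linear (L := fun z => \sw_(v, w <- z) (xi v : k) *: w));
  last by exact: linearP.
rewrite -cointegral_mapE E linearZ /= sw1; [|lin..].
by rewrite !scalerA mulrC.
Qed.

Lemma right_integral_exists : exists mu, right_integral X mu.
Proof.
have [mu E] := cointegral_map_surj 1.
exists mu; split.
  apply/eqP => mu0; move: E; rewrite mu0 linear0 => /eqP.
  by rewrite eq_sym oner_eq0.
apply/right_integralP; rewrite E.
suff -> : mu c = 1 by rewrite scale1r.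
transitivity (eps X (cointegral_map mu)); last by rewrite E rmorph1.
rewrite cointegral_mapE.
rewrite (sw_linear (L := eps X)); last by lin.
rewrite -(sw_counitr X (L := mu)); last by lin.
by apply: eq_sw => x y; rewrite linearZ [LHS]mulrC.
Qed.

Section RightIntegral.
Variables (mu : 'Hom(H, k^o)) (hmu : right_integral X mu).

Lemma cointegral_map_integral : cointegral_map mu = (mu c : k) *: 1.
Proof. by apply/right_integralP; case: hmu. Qed.

(** Otherwise Phi(mu) = mu(c) 1 vanishes, and Phi is injective. *)
Lemma right_integral_cointegral_neq0 : mu c != 0.
Proof.
apply: contraNneq (proj1 hmu) => mu0; apply/eqP/cointegral_map_inj.
by rewrite linear0 cointegral_map_integral mu0 scale0r.
Qed.

Lemma right_integral_unique (nu : 'Hom(H, k^o)) :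
  (forall a, slicel X nu a = nu a *: 1) -> exists b : k, nu = b *: mu.
Proof.
move=> /right_integralP nui; exists ((nu c : k) / (mu c : k)).
apply: cointegral_map_inj; rewrite linearZ /= cointegral_map_integral nui.
by rewrite scalerA divfK // right_integral_cointegral_neq0.
Qed.

(** This inverts S up to the scalar mu(c). *)
Lemma cointegral_map_integral_mul a :
  cointegral_map (mu \o lmulr H (S a))%VF = (mu c : k) *: a.
Proof. by rewrite -cointegral_map_mull cointegral_map_integral -scalerAr mulr1. Qed.

Lemma antipode_inj : injective S.
Proof.
apply: (can_inj (g := fun b => (mu c : k)^-1 *: cointegral_map (mu \o lmulr H b)%VF)).
move=> a; rewrite cointegral_map_integral_mul scalerA mulVf ?scale1r //.
exact: right_integral_cointegral_neq0.
Qed.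

(** As S is onto, x = S(b), and Phi maps the form mu(S(b) -) to mu(c) b. *)
Lemma right_integral_nondeg (x : H) : (forall a : H, mu (x * a) = 0) -> x = 0.
Proof.
move=> x0.
have [b xE] : exists b, x = S b.
  have kS : lker S = 0%VS by apply/eqP/lker0P/antipode_inj.
  have iS : limg S = fullv.
    by apply/eqP; rewrite eqEdim subvf limg_dim_eq /= ?leqnn // kS capv0.
  have: x \in limg S by rewrite iS memvf.
  by case/memv_imgP => b _ ->; exists b.
have : (mu c : k) *: b = 0.
  rewrite -cointegral_map_integral_mul -(linear0 cointegral_map).
  congr (cointegral_map _); apply/lfunP => a.
  by rewrite comp_lfunE lmulrE -xE x0 zero_lfunE.
move/eqP; rewrite scaler_eq0 (negPf right_integral_cointegral_neq0) => /eqP b0.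
by rewrite xE b0 linear0.
Qed.

(** Phi maps both forms mu(- b) and mu(S^2(phi(b)) -) to mu(c) S(phi(b)). *)
Lemma right_integral_nakayama (alpha : {lrmorphism H -> k^o}) (a b : H) :
  (forall b, c * b = (alpha b : k) *: c) ->
  mu (a * b) = mu ((S (S (modular_aut X alpha b)) : H) * a).
Proof.
move=> ca.
have E : (mu \o linfun (fun x => (x * b)%R) =
          mu \o lmulr H (S (S (modular_aut X alpha b))))%VF.
  apply: cointegral_map_inj; rewrite cointegral_map_integral_mul cointegral_mapE.
  under eq_sw => x y.
    rewrite comp_lfunE linear_linfun; last by lin.
  over.
  rewrite (sw_cointegralr (f := fun x y => (mu x : k) *: y) _ _ ca); [|lin..].
  rewrite /modular_aut slicelE (sw_linear (L := S)); last by lin.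
  rewrite (sw_linear (L := fun z => (mu c : k) *: z)); last by lin.
  apply: eq_sw => p q; rewrite lfunE linearZ /= !scalerA mulrC -scalerA.
  rewrite -[S q]mul1r [in RHS]scalerAl -cointegral_map_integral cointegral_mapE.
  congr (_ *: _).
  rewrite (sw_linear (L := fun z => z * S q)); last by lin.
  by apply: eq_sw => x y; rewrite mul1r scalerAl.
have := congr1 (fun h : 'Hom(H, k^o) => h a) E.
by rewrite !comp_lfunE lmulrE linear_linfun //; lin.
Qed.
End RightIntegral.

End Integrals.

(** * Dual bases of projective modules *)
Section DualBasis.
Variables (k : fieldType) (H : falgType k).
Implicit Types P Q V : hmod H.

(** The data of the dual basis lemma: they present P as a direct summand of a
    free module, the q_i being the components of the inclusion. *)
Record dual_basis P (I : finType) (p : I -> P) (q : I -> 'Hom(P, H)) : Prop :=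
  DualBasis {
    dual_basis_hlinear : forall i a x, q i (act P a x) = a * q i x;
    dual_basisE : forall x, x = \sum_i act P (q i x) (p i)
  }.

Lemma dual_basis_projective P (I : finType) (p : I -> P) q :
  dual_basis p q -> projective P.
Proof.
move=> [ql pE] M N s f sl fl s_surj.
have [m mE] : exists m : I -> M, forall i, s (m i) = f (p i).
  by apply: (@fin_all_exists _ _ (fun i m => s m = f (p i))) => i; apply: s_surj.
pose h x := \sum_i act M (q i x) (m i).
have lh : linear h by rewrite /h; lin.
exists (linfun h).
  move=> a x; rewrite !linear_linfun // /h linear_sum /=; apply: eq_bigr => i _.
  by rewrite ql actM comp_lfunE.
apply/lfunP => x; rewrite comp_lfunE linear_linfun // [in RHS](pE x) !linear_sum.
by apply: eq_bigr => i _ /=; rewrite sl fl mE.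
Qed.

Lemma hlinear_comp P Q V (h : 'Hom(P, Q)) (f : 'Hom(Q, V)) :
  hlinear h -> hlinear f -> hlinear (f \o h)%VF.
Proof. by move=> hl fl a x; rewrite !comp_lfunE hl fl. Qed.

Section FreeModule.
Variable n : nat.
Local Notation F := {ffun 'I_n -> H}.

Definition free_act : 'Hom(H, 'End(F)) :=
  linfun (fun a => linfun (fun x : F => [ffun i => a * x i] : F)).

Lemma free_actE a (x : F) i : free_act a x i = a * x i.
Proof.
have l1 (b : H) : linear (fun x : F => [ffun i => b * x i] : F).
  by move=> d y z; apply/ffunP => j; rewrite !ffunE mulrDr scalerAr.
rewrite linear_linfun ?linear_linfun ?ffunE //.
move=> d b b'; apply/lfunP => y; rewrite add_lfunE scale_lfunE !linear_linfun //.
by apply/ffunP => j; rewrite !ffunE mulrDl scalerAl.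
Qed.

Fact free_act1 : free_act 1 = \1%VF.
Proof. by apply/lfunP => x; apply/ffunP => i; rewrite free_actE id_lfunE mul1r. Qed.

Fact free_actM a b : free_act (a * b) = (free_act a \o free_act b)%VF.
Proof.
by apply/lfunP => x; apply/ffunP => i; rewrite comp_lfunE !free_actE mulrA.
Qed.

Definition free_mod : hmod H := HMod free_act1 free_actM.
End FreeModule.

(** An H-linear section of the surjection from a free module that sends the
    generators to the basis of P has the q_i as its components. *)
Lemma projective_dual_basis P :
  projective P -> exists q, dual_basis (@ebasis k P) q.
Proof.
move=> projP; pose n := \dim {:P}.
pose s (x : free_mod n) : P := \sum_i act P (x i) (ebasis i).
have ls : linear s.
  move=> c x y; rewrite /s scaler_sumr -big_split; apply: eq_bigr => i _ /=.
  by rewrite !ffunE linearP add_lfunE scale_lfunE.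
have [||m|h hl hE] := projP (free_mod n) P (linfun s) \1%VF.
- move=> a x; rewrite !(linear_linfun _ ls) /s linear_sum; apply: eq_bigr => i _ /=.
  by rewrite free_actE actM comp_lfunE.
- by move=> a x; rewrite !id_lfunE.
- exists [ffun i => ecoord i m *: 1]; rewrite linear_linfun // /s [RHS]ebasisE.
  by apply: eq_bigr => i _; rewrite ffunE linearZ /= act1 scale_lfunE id_lfunE.
exists (fun i => linfun (fun x => h x i)).
have lh i : linear (fun x => h x i) by move=> c x y; rewrite linearP !ffunE.
split=> [i a x|x]; first by rewrite !linear_linfun // hl free_actE.
have := congr1 (fun f : 'End(P) => f x) hE.
rewrite comp_lfunE id_lfunE linear_linfun // => {1}<-; apply: eq_bigr => i _.
by rewrite linear_linfun.
Qed.

Lemma hreg_dual_basis :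
  dual_basis (P := hreg H) (fun _ : unit => 1 : H) (fun _ => \1%VF).
Proof.
split=> [_ a x|x]; first by rewrite !id_lfunE lmulrE.
by rewrite (big_pred1 tt) => [|[]//]; rewrite id_lfunE lmulrE mulr1.
Qed.

Lemma hreg_projective : projective (hreg H).
Proof. exact: dual_basis_projective hreg_dual_basis. Qed.

(** Both sides equal the double sum of lam(q'_j(h(q_i(f(p'_j)) p_i))). For
    h = id this says that the two dual bases define the same form. *)
Lemma twisted_cyclicity (sigma : {lrmorphism H -> H}) (lam : 'Hom(H, k^o))
    P P' (I J : finType) (p : I -> P) q (p' : J -> P') q'
    (h : 'Hom(P, P')) (f : 'Hom(P', twist sigma P)) :
  (forall a b, lam (a * b) = lam (sigma b * a)) ->
  dual_basis p q -> dual_basis p' q' -> hlinear h -> hlinear f ->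
  \sum_i lam (q i (f (h (p i)))) = \sum_j lam (q' j (h (f (p' j)))).
Proof.
move=> lamC [ql pE] [q'l p'E] hl fl.
transitivity (\sum_i \sum_j lam (q' j (h (act P (q i (f (p' j))) (p i))))).
  apply: eq_bigr => i _; rewrite {1}(p'E (h (p i))) !linear_sum.
  apply: eq_bigr => j _ /=; rewrite fl /= comp_lfunE lfunE /=.
  by rewrite ql -lamC hl q'l.
rewrite exchange_big; apply: eq_bigr => j _ /=.
by rewrite {2}(pE (f (p' j))) !linear_sum.
Qed.
End DualBasis.
Arguments hreg_projective {k H}.

(** * Dual bases of tensor products and the partial trace *)
Section TensorModules.
Variables (k : fieldType) (H : falgType k) (X : hopfStruct H).
Local Notation S := (antipode X).
Local Notation "\sw_ ( x , y <- a ) F" := (sw X (fun x y => F) a).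
Implicit Types P Q V : hmod H.

Lemma htens_actE P V a x v :
  act (htens X P V) a (tpure x v) =
  \sw_(a1, a2 <- a) tpure (act P a1 x) (act V a2 v).
Proof.
rewrite /= /tens_act comp_lfunE sw_lfunE.
rewrite (sw_linear (L := fun h : 'End(_) => h (tpure x v))); last by lin.
by apply: eq_sw => a1 a2; rewrite tactE tmapE.
Qed.

(** a_1 (x) a_2 S(a_3) = a (x) 1. *)
Lemma htens_act_antipode P V a x v :
  tpure (act P a x) v =
  \sw_(a1, a2 <- a) act (htens X P V) a1 (tpure x (act V (S a2) v)).
Proof.
under eq_sw => y z do rewrite htens_actE.
rewrite sw_coassoc.
under eq_sw => u r.
  under eq_sw => w z do rewrite -comp_lfunE -actM.
  rewrite (sw_antipoder X (L := fun w => tpure (act P u x) (act V w v))); last by lin.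
  rewrite act1 id_lfunE.
over.
by rewrite (sw_counitr X (L := fun u => tpure (act P u x) v)) //; lin.
Qed.

(** The coordinate on P (x) V deduced from q and xi through the isomorphism
    h (x) v |-> h_1 (x) S(h_2) v of H (x) V with a free module. *)
Definition tens_coord P V (q : 'Hom(P, H)) (xi : 'Hom(V, k^o)) :
    'Hom(tens P V, H) :=
  tlift (fun x v => \sw_(y, z <- q x) (xi (act V (S z) v) : k) *: y).

Lemma tens_coordE P V (q : 'Hom(P, H)) (xi : 'Hom(V, k^o)) x v :
  tens_coord q xi (tpure x v) =
  \sw_(y, z <- q x) (xi (act V (S z) v) : k) *: y.
Proof.
by rewrite tliftE //; lin.
Qed.

(** (a_1 y)_1 (x) S((a_1 y)_2) a_2 = a_1 y_1 (x) S(y_2) S(a_2) a_3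
    = a y_1 (x) S(y_2). *)
Lemma tens_coord_hlinear P V (q : 'Hom(P, H)) (xi : 'Hom(V, k^o)) a t :
  (forall a x, q (act P a x) = a * q x) ->
  tens_coord q xi (act (htens X P V) a t) = a * tens_coord q xi t.
Proof.
move=> ql; move: t; apply: tens_eq => [||x v]; [lin|lin|].
rewrite htens_actE tens_coordE (sw_linear (L := tens_coord q xi)); last by lin.
pose L b1 u := \sw_(y, z <- q x) (xi (act V (S z * u) v) : k) *: (b1 * y).
transitivity (\sw_(a1, a2 <- a) \sw_(b1, b2 <- a1) L b1 (S b2 * a2)).
  apply: eq_sw => a1 a2; rewrite tens_coordE ql swM; [|lin..].
  apply: eq_sw => b1 b2; apply: eq_sw => y z.
  by rewrite antipodeM mulrA -comp_lfunE -actM.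
rewrite sw_coassoc.
under eq_sw => b1 w.
  rewrite (sw_antipodel X (L := L b1)); last by rewrite /L; lin.
over.
rewrite (sw_counitr X (L := fun b => L b 1)); last by rewrite /L; lin.
rewrite /L (sw_linear (L := fun b => a * b)); last by lin.
by apply: eq_sw => y z; rewrite mulr1 scalerAr.
Qed.

Lemma tens_dual_basis P V (I : finType) (p : I -> P) q :
  dual_basis p q ->
  dual_basis (P := htens X P V)
    (fun ij : I * 'I_(\dim {:V}) => tpure (p ij.1) (ebasis ij.2))
    (fun ij => tens_coord (q ij.1) (linfun (ecoord ij.2 : V -> k^o))).
Proof.
move=> [ql pE]; split=> [ij a t|t]; first exact: tens_coord_hlinear.
move: t; apply: tens_eq => [||x v]; [lin|lin|].
rewrite -(pair_bigA _ (fun i j => act (htens X P V)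
  (tens_coord (q i) (linfun (ecoord j : V -> k^o)) (tpure x v))
  (tpure (p i) (ebasis j)))) /=.
transitivity (\sum_i tpure (act P (q i x) (p i)) v).
  by rewrite {1}(pE x) (lin_bigsum (L := fun y => tpure y v)) //; lin.
apply: eq_bigr => i _.
rewrite htens_act_antipode.
under eq_sw => y z.
  rewrite (lin_ebasis _ (L := fun w => act (htens X P V) y (tpure (p i) w)));
    last by lin.
over.
rewrite sw_sum; apply: eq_bigr => j _; rewrite tens_coordE.
rewrite (sw_linear (L := fun y => act (htens X P V) y (tpure (p i) (ebasis j))));
  last by lin.
by apply: eq_sw => y z; rewrite linearZ scale_lfunE [in RHS]lfunE.
Qed.

Definition slicer (U V : vectType k) (xi : 'Hom(V, k^o)) : 'Hom(tens U V, U) :=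
  tlift (fun u v => (xi v : k) *: u).

Lemma slicerE (U V : vectType k) (xi : 'Hom(V, k^o)) (u : U) v :
  slicer U xi (tpure u v) = (xi v : k) *: u.
Proof. by rewrite tliftE //; lin. Qed.

Section PartialTrace.
Variable g : H.

Definition pivot_coord V (j : 'I_(\dim {:V})) : 'Hom(V, k^o) :=
  (linfun (ecoord j : V -> k^o) \o act V g)%VF.

Lemma pivot_coordE V (j : 'I_(\dim {:V})) v :
  pivot_coord j v = ecoord j (act V g v).
Proof. by rewrite comp_lfunE lfunE. Qed.

Lemma ptraceE (U W : vectType k) V (f : 'Hom(tens U V, tens W V)) u :
  ptrace g f u = \sum_j slicer W (pivot_coord j) (f (tpure u (ebasis j))).
Proof.
rewrite /ptrace !comp_lfunE [X in tmap \1 (coev V) X]linear_linfun; last by lin.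
rewrite tmapE id_lfunE [X in tpure u X]linear_linfun; last by lin.
rewrite [(1 : k^o) *: _]scale1r (lin_bigsum (L := tpure u)); last by lin.
rewrite !linear_sum; apply: eq_bigr => j _ /=.
rewrite tassocVE tmapE id_lfunE.
move: (f _); apply: tens_eq => [||w v]; [lin|lin|].
rewrite tassocE tmapE id_lfunE tliftE; [|lin..].
by rewrite tliftE ?slicerE ?pivot_coordE ?lfunE //; lin.
Qed.

End PartialTrace.
End TensorModules.

(** * The module trace of a linear form *)
Section Traces.
Variables (k : fieldType) (H : falgType k) (X : hopfStruct H).
Local Notation S := (antipode X).
Local Notation "\sw_ ( x , y <- a ) F" := (sw X (fun x y => F) a).
Implicit Types P Q V : hmod H.
Variables (g : H) (hg : is_pivot X g).
Variable sigma : {lrmorphism H -> H}.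

(** Colinearity of sigma makes the twist of P (x) V equal to the tensor product
    of the twist of P with V, which H-linearity of partial traces requires. *)
Definition comodule_twist :=
  Delta X \o sigma =1 tmap (linfun sigma) \1 \o Delta X.

Lemma sw_comodule_twist (U : vectType k) (f : H -> H -> U) a :
  comodule_twist -> (forall y, linear (f^~ y)) -> (forall x, linear (f x)) ->
  sw X f (sigma a) = \sw_(x, y <- a) f (sigma x) y.
Proof.
move=> sD fl fr; rewrite swE [Delta X _]sD /= sw_lfunE (sw_linear (L := tlift f)).
  by apply: eq_sw => x y; rewrite tmapE id_lfunE tliftE // lfunE.
by lin.
Qed.

Lemma pivot_unit : g \is a GRing.unit.
Proof.
have [[gg g1] _] := hg.
apply/unitrP; exists (S g); split.
  have := sw_antipodel X (L := id) g (@lin_id _ _).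
  rewrite sw_grouplike // ?g1 ?scale1r //; lin.
have := sw_antipoder X (L := id) g (@lin_id _ _).
by rewrite sw_grouplike // ?g1 ?scale1r //; lin.
Qed.

Lemma antipode_sqr a : S (S a) * g = g * a.
Proof. by have [_ ->] := hg; rewrite divrK ?pivot_unit. Qed.

(** The sum over j contracts S(x_2) with the action on the second factor, which
    becomes S(x_3) g x_2 = S(S(x_2) x_3) g because S^2(x_2) g = g x_2. *)
Lemma slicer_twist P V (l : 'I_(\dim {:V})) x (t : tens P V) :
  comodule_twist ->
  \sw_(x1, x2 <- x) \sum_j ecoord l (act V (S x2) (ebasis j)) *:
     slicer P (pivot_coord g j) (act (twist sigma (htens X P V)) x1 t) =
  act (twist sigma P) x (slicer P (pivot_coord g l) t).
Proof.
move=> sD; move: t; apply: tens_eq => [||w v]; [lin|lin|].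
pose L y u := (ecoord l (act V (u * g) v)) *: act P (sigma y) w.
transitivity (\sw_(x1, x2 <- x) \sw_(y, z <- x1) L y (S (S z * x2))).
  apply: eq_sw => x1 x2.
  rewrite [act _ x1]comp_lfunE [linfun sigma _]lfunE /=.
  rewrite -[tens_act _ _ _ _]/(act (htens X P V) _).
  rewrite htens_actE sw_comodule_twist //; [|lin..].
  under eq_bigr => j _.
    rewrite (sw_linear (L := fun u => _ *: slicer P (pivot_coord g j) u));
      last by lin.
    under eq_sw => y z do rewrite slicerE pivot_coordE scalerA mulrC -scalerA.
  over.
  rewrite -sw_sum; apply: eq_sw => y z.
  rewrite -(lin_ebasis _
    (L := fun u => ecoord l (act V (S x2) u) *: act P (sigma y) w));
    last by lin.
  by rewrite /L antipodeM -mulrA antipode_sqr mulrA !actM !comp_lfunE.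
rewrite sw_coassoc.
under eq_sw => y r.
  rewrite (sw_antipodel X (L := fun u => L y (S u))); last by rewrite /L; lin.
over.
rewrite (sw_counitr X (L := fun y => L y (S 1))); last by rewrite /L; lin.
rewrite /L antipode1 mul1r slicerE linearZ pivot_coordE /= comp_lfunE.
by rewrite [linfun _ _]lfunE.
Qed.

(** Move x across the tensor sign with htens_act_antipode, use the H-linearity
    of f, and contract with slicer_twist. *)
Lemma ptrace_hlinear P V (f : 'Hom(htens X P V, twist sigma (htens X P V))) :
  comodule_twist -> hlinear f ->
  hlinear (@ptrace k H g P (twist sigma P) V f).
Proof.
move=> sD fl x u; rewrite !ptraceE linear_sum /=.
under eq_bigr => j _.
  rewrite (htens_act_antipode X).
  rewrite (sw_linear (L := fun t => slicer P (pivot_coord g j) (f t)));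
    last by lin.
  under eq_sw => x1 x2.
    rewrite fl (lin_ebasis (act V (S x2) _) (L := fun v => slicer P (pivot_coord g j)
      (act (twist sigma (htens X P V)) x1 (f (tpure u v))))); last by lin.
  over.
over.
rewrite -sw_sum.
under eq_sw => x1 x2 do rewrite exchange_big.
rewrite sw_sum; apply: eq_bigr => l _.
exact: slicer_twist.
Qed.

Lemma hlinear_twist_map P Q (h : 'Hom(P, Q)) :
  hlinear h -> hlinear (twist_map sigma h).
Proof. by move=> hl a x; rewrite /= !comp_lfunE hl. Qed.

(** These are all the H-linear maps from H to its twist, parametrized by the
    image of 1. *)
Definition eval_hom (a : H) : 'Hom(hreg H, twist sigma (hreg H)) :=
  linfun (fun x : H => sigma x * a).

Lemma eval_homE a x : eval_hom a x = sigma x * a.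
Proof. by rewrite linear_linfun //; lin. Qed.

Lemma eval_hom_hlinear a : hlinear (eval_hom a).
Proof.
move=> b x; rewrite !eval_homE /= lmulrE comp_lfunE lmulrE [linfun _ _]lfunE /=.
by rewrite rmorphM mulrA.
Qed.

Lemma hlinear_eval_hom (f : 'Hom(hreg H, twist sigma (hreg H))) :
  hlinear f -> f = eval_hom (f (1 : H)).
Proof.
move=> fl; apply/lfunP => x; rewrite eval_homE.
have := fl x (1 : H).
by rewrite /= lmulrE comp_lfunE lmulrE [linfun _ _]lfunE mulr1.
Qed.

Section TraceOfForm.
Variable lam : 'Hom(H, k^o).
Hypothesis lamC : forall a b : H, lam (a * b) = lam (sigma b * a).

(** A dual basis is chosen for each projective module; the value at any other
    module is arbitrary. *)
Definition trace_of : trace_family sigma := fun P f =>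
  match excluded_middle_informative (exists q, dual_basis (@ebasis k P) q) with
  | left exq =>
      let q := proj1_sig (constructive_indefinite_description _ exq) in
      \sum_i lam (q i (f (ebasis i)))
  | right _ => 0
  end.

Lemma trace_ofE P (I : finType) (p : I -> P) q (f : 'Hom(P, twist sigma P)) :
  dual_basis p q -> hlinear f -> trace_of f = \sum_i lam (q i (f (p i))).
Proof.
move=> pq fl; rewrite /trace_of; case: excluded_middle_informative => [exq|[]].
  case: constructive_indefinite_description => q' pq' /=.
  transitivity (\sum_i lam (q' i (f ((\1%VF : 'Hom(P, P)) (ebasis i))))).
    by apply: eq_bigr => i _; rewrite id_lfunE.
  rewrite (twisted_cyclicity lamC pq' pq) //; last first.
    by move=> a x; rewrite !id_lfunE.
  by apply: eq_bigr => i _; rewrite id_lfunE.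
exact/projective_dual_basis/(dual_basis_projective pq).
Qed.

Lemma trace_of_hreg (f : 'Hom(hreg H, twist sigma (hreg H))) :
  hlinear f -> trace_of f = lam (f (1 : H)).
Proof.
move=> fl; rewrite (trace_ofE (hreg_dual_basis H) fl).
by rewrite (big_pred1 tt) => [|[]//]; rewrite id_lfunE.
Qed.

(** The partial trace condition on lam, equivalent to the integral property
    of lam(g^-1 -), see integral_form_right_integral. *)
Definition integral_form :=
  forall a, \sw_(x, y <- a) (lam x : k) *: S y = (lam a : k) *: g.

(** On x (x) v the claim is the hypothesis for a = q(x), paired with v and the
    l-th coordinate form of V. *)
Lemma integral_form_tens_coord P V (q : 'Hom(P, H)) (l : 'I_(\dim {:V}))
    (t : tens P V) :
  integral_form ->
  lam (tens_coord X q (linfun (ecoord l : V -> k^o)) t) =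
  lam (q (slicer P (pivot_coord g l) t)).
Proof.
move=> lamI; move: t; apply: tens_eq => [||x v]; [lin|lin|].
have l0 : linear (fun b => ecoord l (act V b v) : k^o) by lin.
have /= := congr1 (fun b => ecoord l (act V b v) : k^o) (lamI (q x)).
rewrite (sw_linear _ _ l0) (lin_Z _ _ l0) => E.
rewrite tens_coordE slicerE pivot_coordE !linearZ /= [RHS]mulrC -[RHS]E.
rewrite (sw_linear (L := lam)); last by lin.
apply: eq_sw => y z; rewrite (lin_Z _ _ l0) linearZ [linfun _ _]lfunE.
by rewrite [LHS]mulrC.
Qed.

Lemma trace_of_module_trace :
  comodule_twist -> integral_form -> is_module_trace X g trace_of.
Proof.
move=> sD lamI.
split=> [P projP c f f' fl f'l|P P' projP projP' h f hl fl|P V projP f fl].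
- have [q pq] := projective_dual_basis projP.
  rewrite !(trace_ofE pq) //; last first.
    move=> a x; rewrite !add_lfunE !scale_lfunE.
    by rewrite fl f'l [RHS]linearP.
  rewrite mulr_sumr -big_split; apply: eq_bigr => i _ /=.
  by rewrite add_lfunE scale_lfunE !linearP.
- have [q pq] := projective_dual_basis projP.
  have [q' pq'] := projective_dual_basis projP'.
  rewrite (trace_ofE pq); last exact: hlinear_comp.
  rewrite (trace_ofE pq'); last exact: hlinear_comp fl (hlinear_twist_map hl).
  under eq_bigr => i _ do rewrite comp_lfunE.
  under [RHS]eq_bigr => i _ do rewrite comp_lfunE.
  exact: twisted_cyclicity.
have [q pq] := projective_dual_basis projP.
rewrite (trace_ofE (tens_dual_basis X V pq) fl).
rewrite (trace_ofE pq (ptrace_hlinear sD fl)).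
rewrite -(pair_bigA _ (fun i j =>
  lam (tens_coord X (q i) (linfun (ecoord j : V -> k^o))
    (f (tpure (ebasis i) (ebasis j)))))) /=.
apply: eq_bigr => i _; rewrite ptraceE !linear_sum; apply: eq_bigr => j _ /=.
exact: integral_form_tens_coord.
Qed.
End TraceOfForm.

End Traces.

(** * The linear form of a module trace *)
Section Converse.
Variables (k : fieldType) (H : falgType k) (X : hopfStruct H).
Local Notation S := (antipode X).
Local Notation "\sw_ ( x , y <- a ) F" := (sw X (fun x y => F) a).
Implicit Types P Q V : hmod H.
Variables (g : H) (hg : is_pivot X g).

Section ModuleTrace.
Variables (sigma : {lrmorphism H -> H}) (t : trace_family sigma).
Hypothesis tP : is_module_trace X g t.

Lemma trace_sum P (I : finType) (f : I -> 'Hom(P, twist sigma P)) :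
  projective P -> (forall i, hlinear (f i)) ->
  t (\sum_i f i) = \sum_i t (f i).
Proof.
move=> projP fl.
have l0 : hlinear (0 : 'Hom(P, twist sigma P)).
  by move=> a x; rewrite !zero_lfunE linear0.
have t0 : t (0 : 'Hom(P, twist sigma P)) = 0.
  by have := trace_linear tP projP (-1) l0 l0; rewrite scaler0 addr0 mulN1r addNr.
suff [_ ->] : hlinear (\sum_i f i) /\ t (\sum_i f i) = \sum_i t (f i) by [].
elim/big_ind2 : _ => [|u c v d [ul uE] [vl vE]|i _]; [by []| |by []].
split; first by move=> a x; rewrite !add_lfunE ul vl [RHS]linearD.
by rewrite -uE -vE; have := trace_linear tP projP 1 ul vl; rewrite scale1r mul1r.
Qed.

Definition trace_form : 'Hom(H, k^o) :=
  linfun (fun a : H => t (eval_hom sigma a) : k^o).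

Lemma trace_formE a : trace_form a = t (eval_hom sigma a).
Proof.
rewrite linear_linfun // => c x y.
rewrite -[RHS](trace_linear tP hreg_projective c);
  [|exact: eval_hom_hlinear..].
congr (t _ : k); apply/lfunP => z.
by rewrite add_lfunE scale_lfunE !eval_homE mulrDr scalerAr.
Qed.

Lemma trace_form_hreg (f : 'Hom(hreg H, twist sigma (hreg H))) :
  hlinear f -> t f = trace_form (f (1 : H)).
Proof. by move=> fl; rewrite trace_formE -hlinear_eval_hom. Qed.

Lemma trace_formC (a b : H) : trace_form (a * b) = trace_form (sigma b * a).
Proof.
pose r : 'Hom(hreg H, hreg H) := linfun (fun x : H => x * b).
have rE x : r x = (x : H) * b by rewrite linear_linfun //; lin.
have rl : hlinear r by move=> c x; rewrite !rE /= !lmulrE mulrA.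
have al := @eval_hom_hlinear _ _ sigma a.
have := trace_cyclic tP hreg_projective hreg_projective rl al.
rewrite !trace_formE => E; symmetry; rewrite -[LHS]/(t _).
have <- : (eval_hom sigma a \o r)%VF = eval_hom sigma (sigma b * a).
  by apply/lfunP => x; rewrite comp_lfunE !eval_homE rE rmorphM mulrA.
have <- : (twist_map sigma r \o eval_hom sigma a)%VF = eval_hom sigma (a * b).
  by apply/lfunP => x; rewrite comp_lfunE !eval_homE /twist_map rE mulrA.
by [].
Qed.

(** f is the sum of the composites f r_i q_i through H, with r_i(1) = p_i;
    cyclicity moves q_i to the front. *)
Lemma module_traceE P (I : finType) (p : I -> P) q (f : 'Hom(P, twist sigma P)) :
  dual_basis p q -> hlinear f -> t f = \sum_i trace_form (q i (f (p i))).
Proof.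
move=> pq fl; have projP := dual_basis_projective pq; have [ql pE] := pq.
pose r i : 'Hom(hreg H, P) := linfun (fun x : H => act P x (p i)).
have rE i x : r i x = act P (x : H) (p i) by rewrite linear_linfun //; lin.
have rl i : hlinear (r i).
  by move=> a x; rewrite !rE /= lmulrE actM comp_lfunE.
have q'l i : @hlinear _ _ P (hreg H) (q i) by move=> a x; rewrite ql /= lmulrE.
have frl i := hlinear_comp (rl i) fl.
have fE : f = (\sum_i ((f \o r i) \o (q i : 'Hom(P, hreg H))))%VF.
  apply/lfunP => x; rewrite sum_lfunE {1}(pE x) linear_sum.
  by apply: eq_bigr => i _; rewrite !comp_lfunE rE.
rewrite {1}fE trace_sum // => [|i]; last exact: hlinear_comp (q'l i) (frl i).
apply: eq_bigr => i _; rewrite (trace_cyclic tP projP hreg_projective) //.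
rewrite trace_form_hreg; last exact: hlinear_comp (frl i) (hlinear_twist_map (q'l i)).
by rewrite !comp_lfunE rE act1 id_lfunE.
Qed.

(** The map f : H (x) V -> H (x) V with f(1 (x) v_l) = a (x) v and
    f(1 (x) v_j) = 0 for the other j exists because H (x) V is free on the
    vectors 1 (x) v_j; the partial trace property for f is the claim. *)
Lemma trace_form_partial V (l : 'I_(\dim {:V})) a v :
  comodule_twist X sigma ->
  trace_form (\sw_(y, z <- a) (ecoord l (act V (S z) v) : k) *: y) =
  trace_form ((ecoord l (act V g v) : k) *: a).
Proof.
move=> sD; pose R := hreg H; pose T := htens X R V.
pose q : 'Hom(T, H) :=
  tens_coord X (\1%VF : 'Hom(R, H)) (linfun (ecoord l : V -> k^o)).
have qE b w : q (tpure (b : R) w) =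
    \sw_(y, z <- b) (ecoord l (act V (S z) w) : k) *: y.
  rewrite /q tens_coordE id_lfunE; apply: eq_sw => y z.
  by rewrite [linfun _ _]lfunE.
pose f : 'Hom(T, twist sigma T) :=
  linfun (fun y => act (twist sigma T) (q y) (tpure (a : R) v)).
have fE y : f y = act (twist sigma T) (q y) (tpure (a : R) v).
  by rewrite linear_linfun //; lin.
have fl : hlinear f.
  move=> b y; rewrite !fE -[RHS]comp_lfunE -actM; congr (act (twist sigma T) _ _).
  by apply: tens_coord_hlinear => c x; rewrite !id_lfunE /= lmulrE.
have feE j : f (tpure (1 : R) (ebasis j)) = (j == l)%:R *: tpure (a : R) v.
  rewrite fE qE sw1; [|lin..].
  rewrite antipode1 act1 id_lfunE ecoord_ebasis.
  rewrite (lin_Z (L := act (twist sigma T))) ?scale_lfunE ?act1 ?id_lfunE //; lin.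
have fl1 : f (tpure (1 : R) (ebasis l)) = tpure (a : R) v.
  by rewrite feE eqxx scale1r.
have := trace_partial tP hreg_projective fl.
rewrite (module_traceE (tens_dual_basis X V (hreg_dual_basis H)) fl).
rewrite trace_form_hreg; last exact: ptrace_hlinear.
rewrite ptraceE linear_sum (bigD1 l) //= [X in _ = _ + X -> _]big1 ?addr0; last first.
  by move=> j /negPf jl; rewrite feE jl scale0r !linear0.
rewrite (bigD1 (tt, l)) //= [X in _ + X = _ -> _]big1 ?addr0; last first.
  move=> [[] j] /=; rewrite xpair_eqE /= => /negPf jl.
  by rewrite feE jl scale0r !linear0.
by rewrite fl1 -/q qE slicerE pivot_coordE.
Qed.

Lemma trace_form_integral : comodule_twist X sigma -> integral_form X g trace_form.
Proof.
move=> sD a; apply: ecoord_inj => l.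
have := trace_form_partial (V := hreg H) l a (1 : H) sD.
rewrite [in X in _ = X -> _]/= lmulrE mulr1 linearZ /= => E.
rewrite (lin_Z (L := ecoord l : H -> k^o)); last by exact: linearP.
rewrite [RHS]mulrC -[RHS]E.
rewrite (sw_linear (L := ecoord l : H -> k^o)); last by exact: linearP.
rewrite (sw_linear (L := trace_form)); last by lin.
apply: (@eq_sw _ _ X k^o) => y z; rewrite !linearZ /= lmulrE mulr1.
exact: mulrC.
Qed.

End ModuleTrace.

(** Both conditions are equivalent to lam(a_1) g a_2 = lam(a) 1: expand
    lam(a_1) S(a_2) a_3 in one direction and lam(a_1) g a_2 S(a_3) in the
    other. *)
Lemma integral_form_right_integral (mu : 'Hom(H, k^o)) :
  integral_form X g (mu \o lmulr H g)%VF <->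
  forall a, slicel X mu a = mu a *: 1.
Proof.
pose lam := (mu \o lmulr H g)%VF.
have lamE a : lam a = mu (g * a) by rewrite comp_lfunE lmulrE.
have E a : slicel X mu (g * a) = \sw_(y, z <- a) (lam y : k) *: (g * z).
  have [gl _] := hg.
  rewrite slicelE swM; [|lin..].
  rewrite sw_grouplike //; [|lin..].
  by apply: eq_sw => y z; rewrite lamE.
have -> : (forall a, slicel X mu a = mu a *: 1) <->
    (forall a, \sw_(y, z <- a) (lam y : k) *: (g * z) = lam a *: 1).
  split=> I a; first by rewrite -E I lamE.
  by rewrite -[a](mulVKr (pivot_unit hg)) E I lamE.
split=> I a.
- transitivity (\sw_(x, r <- a) (\sw_(y, z <- x) (lam y : k) *: S z) * r).
    by apply: eq_sw => x r; rewrite I scalerAl.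
  under eq_sw => x r.
    rewrite (sw_linear (L := fun w => w * r)); last by lin.
    under eq_sw => y z do rewrite -scalerAl.
  over.
  rewrite sw_coassoc.
  under eq_sw => y w.
    rewrite (sw_antipodel X (L := fun u => (lam y : k) *: u)); last by lin.
  over.
  by rewrite (sw_counitr X (L := fun y => (lam y : k) *: (1 : H))) //; lin.
transitivity (\sw_(x, r <- a) (\sw_(y, z <- x) (lam y : k) *: (g * z)) * S r).
  by apply: eq_sw => x r; rewrite I -scalerAl mul1r.
under eq_sw => x r.
  rewrite (sw_linear (L := fun w => w * S r)); last by lin.
  under eq_sw => y z do rewrite -scalerAl -mulrA.
over.
rewrite sw_coassoc.
under eq_sw => y w.
  rewrite (sw_antipoder X (L := fun u => (lam y : k) *: (g * u))); last by lin.
  rewrite mulr1.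
over.
by rewrite (sw_counitr X (L := fun y => (lam y : k) *: g)) //; lin.
Qed.
End Converse.

(** * Module traces and right integrals *)
Section Main.
Variables (k : fieldType) (H : falgType k) (X : hopfStruct H).
Local Notation "\sw_ ( x , y <- a ) F" := (sw X (fun x y => F) a).

Lemma modular_autE (alpha : {lrmorphism H -> k^o}) a :
  modular_aut X alpha a = \sw_(p, q <- a) (alpha p : k) *: q.
Proof. by rewrite /modular_aut slicelE; apply: eq_sw => p q; rewrite lfunE. Qed.

(** Coassociativity: alpha(a_1) a_2 (x) a_3 is both sides. *)
Lemma modular_aut_twist (alpha : {lrmorphism H -> k^o}) :
  comodule_twist X (modular_aut X alpha).
Proof.
move=> a; rewrite /= [modular_aut X alpha a]modular_autE.
rewrite (sw_linear (L := Delta X)); last by lin.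
rewrite (sw_lfunE X (tmap (linfun (modular_aut X alpha)) \1)).
under [RHS]eq_sw => x v.
  rewrite tmapE id_lfunE [linfun _ x]lfunE /= modular_autE.
  rewrite (sw_linear (L := fun w => tpure w v)); last by lin.
over.
rewrite sw_coassoc; apply: eq_sw => p q.
rewrite linearZ /= -{1}(sw_tpure X q).
rewrite (sw_linear (L := fun w => (alpha p : k) *: w));
  last by lin.
by apply: eq_sw => u v; rewrite tpureZl.
Qed.

Lemma idfun_twist : comodule_twist X idfun.
Proof.
by move=> a; rewrite /= (_ : linfun idfun = \1%VF) ?tmap_id ?id_lfunE //.
Qed.

Lemma modular_aut_counit (alpha : {lrmorphism H -> k^o}) a :
  eps X (modular_aut X alpha a) = alpha a.
Proof.
rewrite modular_autE (sw_linear (L := eps X)); last by lin.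
rewrite -[RHS](sw_counitr X (L := alpha)); last by lin.
by apply: eq_sw => p q; rewrite linearZ [LHS]mulrC.
Qed.

(** The counit recovers alpha from its modular automorphism. *)
Lemma modular_aut_id (alpha : {lrmorphism H -> k^o}) :
  (modular_aut X alpha =1 id) <-> (alpha =1 eps X).
Proof.
split=> [phi1 a|E a]; first by rewrite -modular_aut_counit phi1.
rewrite modular_autE -[RHS](sw_counitl X (L := id)); last by lin.
by apply: eq_sw => p q; rewrite E.
Qed.

Variables (g : H) (hg : is_pivot X g).
Variables (alpha : {lrmorphism H -> k^o}) (halpha : is_modulus X alpha).
Local Notation phi := (modular_aut X alpha).

Lemma integral_modular_cyclic (mu : 'Hom(H, k^o)) (a b : H) :
  right_integral X mu ->
  mu (g * (a * b)) = mu (g * (phi b * a)).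
Proof.
case: halpha => c hc ca hmu.
rewrite mulrA (right_integral_nakayama hc hmu _ _ ca).
by rewrite mulrA antipode_sqr // !mulrA.
Qed.

(** Stated for any sigma equal to phi pointwise, so that it also yields modified
    traces when phi is the identity. *)
Lemma module_trace_of_integral (sigma : {lrmorphism H -> H}) (mu : 'Hom(H, k^o)) :
  right_integral X mu -> comodule_twist X sigma -> phi =1 sigma ->
  exists2 t : trace_family sigma, is_module_trace X g t &
    forall f : 'Hom(hreg H, twist sigma (hreg H)), hlinear f ->
      t (hreg H) f = mu (g * f (1 : H)).
Proof.
move=> hmu sD phiE; pose lam := (mu \o lmulr H g)%VF.
have lamE a : lam a = mu (g * a) by rewrite comp_lfunE lmulrE.
have lamC (a b : H) : lam (a * b) = lam (sigma b * a).
  by rewrite !lamE -phiE integral_modular_cyclic.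
exists (trace_of lam) => [|f fl]; last by rewrite trace_of_hreg // lamE.
apply: trace_of_module_trace => //.
by apply/(integral_form_right_integral hg); case: hmu.
Qed.

(** The form lam of a module trace is mu(g -) for mu = lam(g^-1 -). If mu = 0,
    then the trace vanishes by module_traceE. *)
Lemma integral_of_module_trace (sigma : {lrmorphism H -> H})
    (t : trace_family sigma) :
  comodule_twist X sigma -> is_module_trace X g t ->
  exists mu : 'Hom(H, k^o),
    [/\ forall a, slicel X mu a = mu a *: 1,
        forall a, trace_form t a = mu (g * a) &
        nonzero_trace t -> right_integral X mu].
Proof.
move=> sD tP; pose mu := (trace_form t \o lmulr H (g^-1)%R)%VF.
have muE a : trace_form t a = mu (g * a).
  by rewrite comp_lfunE lmulrE mulKr ?(pivot_unit hg).
have muI : forall a, slicel X mu a = mu a *: 1.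
  apply/(integral_form_right_integral hg).
  rewrite (_ : (mu \o lmulr H g)%VF = trace_form t).
    exact: trace_form_integral.
  by apply/lfunP => a; rewrite muE [LHS]comp_lfunE lmulrE.
exists mu; split=> // tn0; split=> //; apply/eqP => mu0; apply: tn0.
move=> P projP f fl; have [q pq] := projective_dual_basis projP.
rewrite (module_traceE tP pq fl) big1 // => i _.
by rewrite muE mu0 zero_lfunE.
Qed.

Lemma nonzero_trace_of_integral (sigma : {lrmorphism H -> H})
    (t : trace_family sigma) (mu : 'Hom(H, k^o)) :
  is_module_trace X g t -> right_integral X mu ->
  (forall f : 'Hom(hreg H, twist sigma (hreg H)), hlinear f ->
      t (hreg H) f = mu (g * f (1 : H))) -> nonzero_trace t.
Proof.
move=> tP [mu0 _] tE t0; case/eqP: mu0; apply/lfunP => a; rewrite zero_lfunE.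
have fl := @eval_hom_hlinear _ _ sigma (g^-1 * a).
have := t0 _ hreg_projective _ fl.
by rewrite tE // eval_homE rmorph1 mul1r mulVKr ?(pivot_unit hg).
Qed.

Lemma eq_module_trace (sigma : {lrmorphism H -> H}) (t t' : trace_family sigma)
    (c : k) :
  is_module_trace X g t -> is_module_trace X g t' ->
  (forall a, trace_form t a = c * trace_form t' a) ->
  eq_trace t (trace_scale c t').
Proof.
move=> tP t'P E P projP f fl; have [q pq] := projective_dual_basis projP.
rewrite /trace_scale (module_traceE tP pq fl) (module_traceE t'P pq fl) mulr_sumr.
by apply: eq_bigr => i _; apply: E.
Qed.
End Main.

Theorem theorem1p1 (k : fieldType) (H : falgType k) (X : hopfStruct H)
    (g : H) (hg : is_pivot X g)
    (alpha : {lrmorphism H -> k^o}) (halpha : is_modulus X alpha) :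
  let phi : {lrmorphism H -> H} := modular_aut X alpha in
  [/\ traces_dim1 X g phi,
      (forall t t' : trace_family phi,
         is_module_trace X g t -> is_module_trace X g t' ->
         (forall f : 'Hom(hreg H, twist phi (hreg H)), hlinear f ->
            t (hreg H) f = t' (hreg H) f) ->
         eq_trace t t'),
      (forall mu : 'Hom(H, k^o), right_integral X mu ->
         exists2 t : trace_family phi, is_module_trace X g t &
           forall f : 'Hom(hreg H, twist phi (hreg H)), hlinear f ->
             t (hreg H) f = mu (g * f (1 : H))),
      (forall t : trace_family phi,
         is_module_trace X g t -> nonzero_trace t ->
         exists2 mu : 'Hom(H, k^o), right_integral X mu &
           forall f : 'Hom(hreg H, twist phi (hreg H)), hlinear f ->
             t (hreg H) f = mu (g * f (1 : H))) &
      ((exists2 t : trace_family idfun,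
          is_modified_trace X g t & nonzero_trace t)
       <-> alpha =1 eps X)].
Proof.
move=> phi; have phiD : comodule_twist X phi by exact: modular_aut_twist.
have [c hc _] := halpha; have [mu hmu] := right_integral_exists hc.
split.
- have [t0 t0P t0E] := module_trace_of_integral hg halpha hmu phiD (frefl _).
  exists t0; split=> //; first exact: nonzero_trace_of_integral t0P hmu t0E.
  move=> t tP; have [nu [nuI nuE _]] := integral_of_module_trace hg phiD tP.
  have [b nuMu] := right_integral_unique hc hmu nuI.
  exists b; apply: (eq_module_trace tP t0P) => a.
  rewrite nuE nuMu scale_lfunE (trace_formE t0P) t0E; last exact: eval_hom_hlinear.
  by rewrite eval_homE rmorph1 mul1r.
- move=> t t' tP t'P tt' P projP f fl.
  rewrite (eq_module_trace (c := 1) tP t'P) // => [|a]; first exact: mul1r.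
  rewrite mul1r (trace_formE tP) (trace_formE t'P) tt' //.
  exact: eval_hom_hlinear.
- by move=> nu hnu; apply: (module_trace_of_integral hg halpha hnu phiD (frefl _)).
- move=> t tP tn0; have [nu [_ nuE hnu]] := integral_of_module_trace hg phiD tP.
  exists nu; first exact: hnu.
  by move=> f fl; rewrite (trace_form_hreg tP fl) nuE.
split=> [[t tP0 tn0]|alphaE].
  have tP : is_module_trace X g t by exact: tP0.
  have [nu [_ nuE /(_ tn0) hnu]] := integral_of_module_trace hg (idfun_twist X) tP.
  (* mu(g a b) is mu(g phi(b) a) by the Nakayama identity and mu(g b a) by
     cyclicity of the modified trace, so that g (phi(b) - b) = 0. *)
  apply/modular_aut_id => b; apply/eqP; rewrite -subr_eq0; apply/eqP.
  apply: (can_inj (mulKr (pivot_unit hg))); rewrite mulr0.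
  apply: (right_integral_nondeg hc hnu) => a.
  rewrite -mulrA mulrBl mulrBr linearB /= -(integral_modular_cyclic hg halpha) //.
  by rewrite -!nuE (trace_formC tP) subrr.
have phi1 := proj2 (modular_aut_id X alpha) alphaE.
have [t tP tE] := module_trace_of_integral hg halpha hmu (idfun_twist X) phi1.
by exists t; [exact: tP | apply: nonzero_trace_of_integral tP hmu tE].
Qed.
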